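(* Let $G$ be a finite 3-connected graph, $G'$ a graph, and $f:G\rightarrow G'$ a circuit surjection. Then $f$ is induced by a vertex isomorphism, i.e. there is a bijection $\varphi:V(G)\to V(G')$ such that $f(uv)=\varphi(u)\varphi(v)$ for every edge $uv$ of $G$ (in particular $G\cong G'$).
   Context: Graphs are undirected, without loops or multiple edges. A circuit surjection $f:G\rightarrow G'$ is a map from $E(G)$ onto $E(G')$ such that for every circuit $C$ of $G$, $f(C)$ is a circuit of $G'$; $G'$ is required to have no isolated vertices. *)

(* Defs.v *)
From HB Require Import structures.
From mathcomp Require Import all_boot.
From mathcomp Require Import finmap.
Set Implicit Arguments. Unset Strict Implicit. Unset Printing Implicit Defensive.

(* Simple finite graph G: vertex type T : finType, symmetric irreflexive
   adjacency g : rel T.  An edge uv is represented by the 2-set [set u; v]. *)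

Definition edgesG (T : finType) (g : rel T) : {set {set T}} :=
  [set [set p.1; p.2] | p in [set p : T * T | g p.1 p.2]].

Definition circuitG (T : finType) (g : rel T) (C : {set {set T}}) : Prop :=
  exists s : seq T,
    [/\ uniq s, 2 < size s, cycle g s & C = [set [set x; next s x] | x in s]].

Definition connected_on (T : finType) (g : rel T) (A : {set T}) : Prop :=
  forall x y, x \in A -> y \in A ->
    connect [rel u v | [&& g u v, u \in A & v \in A]] x y.

Definition k_connected (k : nat) (T : finType) (g : rel T) : Prop :=
  k < #|T| /\ forall S : {set T}, #|S| < k -> connected_on g (~: S).

Local Open Scope fset_scope.

Definition edgeG' (V' : choiceType) (e' : rel V') (x : {fset V'}) : Prop :=
  exists a b, e' a b /\ x = [fset a; b].

Definition circuitG' (V' : choiceType) (e' : rel V') (D : {fset V'} -> Prop)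
  : Prop :=
  exists s : seq V',
    [/\ uniq s, 2 < size s, cycle e' s &
        forall x, D x <-> exists2 y, y \in s & x = [fset y; next s y]].

(* f : E(G) -> E(G') (given as a function on 2-sets, only its values on
   edges of G matter) is a circuit surjection *)
Definition circuit_surjection (T : finType) (g : rel T)
  (V' : choiceType) (e' : rel V') (f : {set T} -> {fset V'}) : Prop :=
  [/\ (forall x, x \in edgesG g -> edgeG' e' (f x)),
      (forall x', edgeG' e' x' -> exists2 x, x \in edgesG g & f x = x') &
      (forall C, circuitG g C ->
         circuitG' e' (fun x' => exists2 x, x \in C & f x = x'))].

(* Main.v *)
Require Import Defs.
From HB Require Import structures.
From mathcomp Require Import all_boot.
From mathcomp Require Import finmap.
From mathcomp Require Import zify.
From Stdlib Require Import Classical.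

(* For a vertex a of G', let X_a be the set of edges x of G with a in f(x).  Every circuit
   C of G satisfies: f(C) has 0 or 2 edges at a.

   Injectivity.  If three circuits of G form a theta and their images have a common edge, a
   parity count at each vertex of G' shows that the three images coincide.  If f(x) = f(y)
   with x <> y, take a theta with x and y on different paths; its circuits have a common
   image D.  Any further edge lies on an ear of this theta and is shown to be mapped into D,
   hence D is the image of every circuit of G, and for each d in D the edges not mapped to d
   form a forest.  Three such forests cover every edge twice, so 2|E| < 3|V|, although all
   degrees are at least 3.

   Stars.  Now every circuit meets X_a in 0 or 2 edges.  Two disjoint circuits meeting X_a
   would be linked by three disjoint paths (Menger), producing a circuit with at least three
   edges in X_a.  Since an edge outside X_a lies on a circuit avoiding X_a, and G' - a is
   connected, the edges outside X_a lie in a single component of G - X_a; the ends of an edge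
   of X_a lie in different components, so one of them is isolated in G - X_a, and X_a is the
   star of this vertex. *)

Set Implicit Arguments. Unset Strict Implicit. Unset Printing Implicit Defensive.

(** * Walks and Menger's theorem *)

Lemma uniq_countP (T : eqType) (s : seq T) :
  reflect (forall x, count_mem x s <= 1) (uniq s).
Proof.
apply: (iffP idP) => [us x|cs]; first by rewrite count_uniq_mem // leq_b1.
by apply/count_mem_uniq => x; have := cs x; have := has_pred1 x s; rewrite has_count;
   case: (count_mem x s) => [|[|n]] //= <-.
Qed.

Section Steps.
Variable T : Type.
Implicit Types (x y : T) (s : seq T).

Definition steps s : seq (T * T) := zip s (behead s).

Lemma steps_cat s x t : steps (s ++ x :: t) = steps (rcons s x) ++ steps (x :: t).
Proof. by elim: s => [|a [|b s] IH] //=; rewrite /steps /= in IH *; rewrite IH. Qed.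

Lemma steps_rcons2 s x y : steps (rcons (rcons s x) y) = rcons (steps (rcons s x)) (x, y).
Proof. by rewrite -cats1 cat_rcons steps_cat cats1. Qed.

Lemma path_steps (e : rel T) x s :
  path e x s = all (fun q => e q.1 q.2) (steps (x :: s)).
Proof. by elim: s x => [|y s IH] x //=; rewrite IH. Qed.

Lemma steps_cons2 x y s : steps [:: x, y & s] = (x, y) :: steps (y :: s).
Proof. by []. Qed.

Lemma steps_rev s : steps (rev s) = rev [seq (q.2, q.1) | q <- steps s].
Proof.
elim: s => [|x [|y s] IH] //.
rewrite rev_cons [in LHS]rev_cons steps_rcons2 -rev_cons IH steps_cons2 map_cons.
by rewrite [RHS]rev_cons.
Qed.

Definition walk (e : rel T) s := all (fun q => e q.1 q.2) (steps s).

Arguments walk : simpl never.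

Lemma walk_cat e s x t : walk e (s ++ x :: t) = walk e (rcons s x) && walk e (x :: t).
Proof. by rewrite /walk steps_cat all_cat. Qed.

Lemma walk_path e x s : walk e (x :: s) = path e x s.
Proof. by rewrite path_steps. Qed.

Lemma walk_cons2 e x y s : walk e [:: x, y & s] = e x y && walk e (y :: s).
Proof. by []. Qed.

Lemma walk_rcons2 e s x y : walk e (rcons (rcons s x) y) = walk e (rcons s x) && e x y.
Proof. by rewrite /walk steps_rcons2 all_rcons andbC. Qed.

Lemma walk_rev e s : symmetric e -> walk e (rev s) = walk e s.
Proof.
move=> es; rewrite /walk steps_rev all_rev all_map; apply: eq_all => q /=.
exact: es.
Qed.

End Steps.

Lemma mem_steps (T : eqType) (s : seq T) u v :
  (u, v) \in steps s -> u \in s /\ v \in s.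
Proof.
elim: s => [|x [|y s] IH] //=; rewrite !inE => /orP[/eqP[-> ->]|/IH[]].
  by rewrite !eqxx ?orbT.
by rewrite !inE => -> ->; rewrite !orbT.
Qed.

(** The bridge between two notations for a circuit: [next] on a cyclic list, as in [circuitG] and
    [circuitG'], and the steps of the list closed up by repeating its first vertex. *)
Lemma next_steps (T : eqType) (x : T) p u v : uniq (x :: p) ->
  ((u, v) \in steps (x :: rcons p x)) = (u \in x :: p) && (v == next (x :: p) u).
Proof.
move=> up; have -> : steps (x :: rcons p x) = zip (x :: p) (rcons p x).
  rewrite /steps /= -rcons_cons -(cats1 (x :: p)) -[in LHS](cats0 (rcons p x)).
  by rewrite zip_cat ?cats0 // size_rcons.
have sz : size (x :: p) = size (rcons p x) by rewrite size_rcons.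
have nE i : i < size (x :: p) -> nth x (rcons p x) i = next (x :: p) (nth x (x :: p) i).
  move=> li; rewrite next_nth mem_nth // index_uniq // nth_rcons.
  by have [//|ge] := ltnP i (size p); rewrite [RHS]nth_default //; case: eqP.
apply/idP/andP => [/(nthP (x, x))[i]|[ui /eqP->]].
- rewrite size_zip -sz minnn => li; rewrite nth_zip // => -[<- <-].
  by rewrite mem_nth // nE.
- apply/(nthP (x, x)); exists (index u (x :: p)); rewrite ?size_zip -?sz ?minnn ?index_mem //.
  by rewrite nth_zip // nE ?index_mem // nth_index.
Qed.

Section Menger.
Variable T : finType.
Implicit Types (e : rel T) (A B C S : {set T}).

(** Repeated vertices and inner visits to [A] or [B] are allowed, and [e] is read as directed; a
    single vertex common to both sets counts. *)
Definition ABpath e A B s :=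
  if s is x :: p then [&& x \in A, walk e s & last x p \in B] else false.

Lemma ABpath_prefix e A B C s1 z s2 :
  ABpath e A B (s1 ++ z :: s2) -> z \in C -> ABpath e A C (rcons s1 z).
Proof.
case: s1 => [|x s1] /=; first by case/and3P=> -> _ _ ->.
rewrite -cat_cons walk_cat => /and3P[-> /andP[w _] _] zC.
by rewrite -rcons_cons w last_rcons.
Qed.

Lemma ABpath_suffix e A B C s1 z s2 :
  ABpath e A B (s1 ++ z :: s2) -> z \in C -> ABpath e C B (z :: s2).
Proof.
case: s1 => [|x s1] /=; first by case/and3P=> _ -> -> ->.
by rewrite -cat_cons walk_cat last_cat => /and3P[_ /andP[_ ->] /= ->] ->.
Qed.

Lemma ABpath_cat e A B C C' s1 z s2 :
  ABpath e A C (rcons s1 z) -> ABpath e C' B (z :: s2) -> ABpath e A B (s1 ++ z :: s2).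
Proof.
case: s1 => [|x s1] /=; first by move=> /andP[-> _] /and3P[_ -> ->].
by rewrite -cat_cons walk_cat last_cat rcons_cons => /and3P[-> -> _] /and3P[_ -> /= ->].
Qed.

Lemma ABpath_cat2 e A B C C' s1 x y s2 : e x y ->
  ABpath e A C (rcons s1 x) -> ABpath e C' B (y :: s2) ->
  ABpath e A B (rcons s1 x ++ y :: s2).
Proof.
move=> exy p1 p2; apply: (@ABpath_cat _ _ _ [set y] C') => //.
case: s1 p1 => [|a s1] /=; first by case/andP=> -> _; rewrite walk_cons2 exy inE eqxx.
case/and3P=> -> w _; rewrite -!rcons_cons walk_rcons2 rcons_cons w exy.
by rewrite last_rcons inE eqxx.
Qed.

Lemma ABpath_rconsE e A B s : ABpath e A B s -> exists s1 z, s = rcons s1 z /\ z \in B.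
Proof.
case/lastP: s => // s z h; exists s, z; split=> //.
by case: s h => [|x s] /and3P[_ _]; rewrite ?last_rcons.
Qed.

Lemma ABpath_consE e A B s : ABpath e A B s -> exists z s1, s = z :: s1 /\ z \in A.
Proof. by case: s => // z s /and3P[zA _ _]; exists z, s. Qed.

Lemma sub_ABpath e e' A B s :
  (forall u v, (u, v) \in steps s -> e u v -> e' u v) -> ABpath e A B s -> ABpath e' A B s.
Proof.
case: s => // x p h /and3P[xA w pB]; rewrite /ABpath xA pB andbT /=.
by apply/allP => -[u v] q; apply: h => //; exact: (allP w _ q).
Qed.

Definition separates e A B S := forall s, ABpath e A B s -> has (mem S) s.

Definition disjoint_paths e A B k (p : 'I_k -> seq T) :=
  (forall i, ABpath e A B (p i) /\ uniq (p i)) /\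
  (forall i j x, x \in p i -> x \in p j -> i = j).

Lemma split_has (a : pred T) s : has a s ->
  exists s1 z s2, [/\ s = s1 ++ z :: s2, a z & ~~ has a s1].
Proof.
elim: s => //= x s IH; case: (boolP (a x)) => [ax _|/negPf ax /= /IH[s1 [z [s2 [-> az n1]]]]].
  by exists [::], x, s.
by exists (x :: s1), z, s2; split=> //=; rewrite ax.
Qed.

Lemma split_has_last (a : pred T) s : has a s ->
  exists s1 z s2, [/\ s = s1 ++ z :: s2, a z & ~~ has a s2].
Proof.
rewrite -has_rev => /split_has[s1 [z [s2 [eq az n1]]]].
exists (rev s2), z, (rev s1); split; rewrite ?has_rev //.
by rewrite -[s]revK eq rev_cat rev_cons cat_rcons.
Qed.

(* Goering's induction on the number of edges. *)
Theorem menger e A B k :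
  (forall S, separates e A B S -> k <= #|S|) ->
  exists p : 'I_k -> seq T, disjoint_paths e A B p.
Proof.
move: {2}_.+1 (ltnSn #|[set q : T * T | e q.1 q.2]|) => n.
elim: n e A B => // n IH e A B len sep.
case: (pickP (fun q : T * T => e q.1 q.2)) => [[x y] /= exy|e0]; last first.
  (* Without arcs every path is a single vertex, so [A :&: B] separates and its vertices serve as
     the [k] paths. *)
  have le : k <= #|A :&: B|.
    apply: sep => -[|a [|b s]] //= => [/andP[aA aB]|]; first by rewrite inE aA aB.
    by rewrite walk_cons2 (e0 (a, b)) /= andbF.
  have [x0 _|/eq_card0 z] := pickP (mem (A :&: B)); last first.
    have k0 : k = 0 by move: le; rewrite z; case: (k).
    by subst; exists (fun=> [::]); split=> [[]|[]].
  exists (fun i => [:: nth x0 (enum (A :&: B)) i]); split=> [i|i j z].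
    have : nth x0 (enum (A :&: B)) i \in A :&: B.
      by rewrite -mem_enum mem_nth // -cardE (leq_trans (ltn_ord i)).
    by rewrite inE => /andP[zA zB]; rewrite /= zA zB.
  rewrite !inE => /eqP-> /eqP/(congr1 (index^~ (enum (A :&: B)))).
  rewrite !index_uniq ?enum_uniq -?cardE ?(leq_trans (ltn_ord _)) // => h.
  exact: val_inj.
pose e1 := [rel u v | e u v && ((u, v) != (x, y))].
have len1 : #|[set q : T * T | e1 q.1 q.2]| < n.
  rewrite ltnS in len; apply: leq_trans len; apply: proper_card; apply/properP; split.
    by apply/subsetP=> -[u v]; rewrite !inE /= => /andP[].
  by exists (x, y); rewrite !inE /= exy ?eqxx.
have sub1 s A1 B1 : ABpath e1 A1 B1 s -> ABpath e A1 B1 s.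
  by apply: sub_ABpath => u v _ /andP[].
case: (classic (forall S, separates e1 A B S -> k <= #|S|)) => [sep1|nsep].
  have [p [h dj]] := IH e1 A B len1 sep1; exists p; split=> // i.
  by have [/sub1 ? ?] := h i.
(* Without the arc [xy], fewer than [k] vertices [S] separate. Adding [x], or adding [y], gives a
   separator for [e], so both enlarged sets have exactly [k] vertices. *)
have [S [sepS ltS]] : exists S, separates e1 A B S /\ #|S| < k.
  apply: NNPP => nS; apply: nsep => S sepS; rewrite leqNgt; apply/negP => ltS.
  by apply: nS; exists S.
have e1I s A1 B1 : ABpath e A1 B1 s -> (x, y) \notin steps s -> ABpath e1 A1 B1 s.
  move=> h n1; apply: sub_ABpath h => u v uv /= -> /=.
  by apply: contraNneq n1 => <-.
have sepx : separates e A B (x |: S).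
  move=> s h; have [xy|/(e1I _ _ _ h)/sepS/hasP[z zs zS]] := boolP ((x, y) \in steps s).
    by apply/hasP; exists x; [case: (mem_steps xy)|exact: setU11].
  by apply/hasP; exists z; rewrite //; exact: (setU1r x zS).
have sepy : separates e A B (y |: S).
  move=> s h; have [xy|/(e1I _ _ _ h)/sepS/hasP[z zs zS]] := boolP ((x, y) \in steps s).
    by apply/hasP; exists y; [case: (mem_steps xy)|exact: setU11].
  by apply/hasP; exists z; rewrite //; exact: (setU1r y zS).
have [xS cx] : x \notin S /\ #|x |: S| = k.
  by have := sep _ sepx; rewrite cardsU1; case: (x \in S) => /=; lia.
have [yS cy] : y \notin S /\ #|y |: S| = k.
  by have := sep _ sepy; rewrite cardsU1; case: (y \in S) => /=; lia.
(* Up to its first vertex in [x |: S] a path cannot use the arc [xy], so a set separating [A] from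
   [x |: S] without that arc separates [A] from [B]. The part after the last vertex in [y |: S] is
   then treated likewise. *)
have [p [hp dp]] : exists p : 'I_k -> seq T, disjoint_paths e1 A (x |: S) p.
  apply: IH => // S' sepS'; apply: sep => s h.
  have [s1 [z [s2 [eqs zS n1]]]] := split_has (sepx _ h).
  subst s; have h1 := ABpath_prefix h zS.
  have /sepS'/hasP[w] : ABpath e1 A (x |: S) (rcons s1 z).
    apply: e1I h1 _; apply/negP; rewrite /steps.
    case/lastP: s1 n1 {h} => // s1 a n1; rewrite -/(steps _) steps_rcons2 mem_rcons inE.
    have nx v : (x, v) \notin steps (rcons s1 a).
      apply/negP=> /mem_steps[xs _]; case/negP: n1; apply/hasP.
      by exists x; rewrite //= setU11.
    rewrite (negPf (nx y)) orbF => /eqP[ax _].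
    by case/negP: n1; rewrite has_rcons -ax /= setU11.
  by rewrite mem_rcons => ws wS; apply/hasP; exists w;
     rewrite // mem_cat inE; move: ws; rewrite inE => /orP[->|->]; rewrite ?orbT.
have [q [hq dq]] : exists q : 'I_k -> seq T, disjoint_paths e1 (y |: S) B q.
  apply: IH => // S' sepS'; apply: sep => s h.
  have [s1 [z [s2 [eqs zS n1]]]] := split_has_last (sepy _ h).
  subst s; have h1 := ABpath_suffix h zS.
  have /sepS'/hasP[w ws wS] : ABpath e1 (y |: S) B (z :: s2).
    apply: e1I h1 _; apply/negP; case: s2 n1 {h} => // a s2 n1.
    rewrite steps_cons2 inE => /orP[/eqP[_ ya]|/mem_steps[_ ys]].
      by case/negP: n1; rewrite /= -ya setU11.
    by case/negP: n1; apply/hasP; exists y; rewrite //= setU11.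
  by apply/hasP; exists w; rewrite // mem_cat ws orbT.
have [a /fin_all_exists[l pE]] := fin_all_exists (fun i => ABpath_rconsE (hp i).1).
have [h /fin_all_exists[b qE]] := fin_all_exists (fun i => ABpath_consE (hq i).1).
have lS i : l i \in x |: S by case: (pE i).
have hS i : h i \in y |: S by case: (qE i).
have lp i : l i \in p i by rewrite (pE i).1 mem_rcons mem_head.
have hq' i : h i \in q i by rewrite (qE i).1 mem_head.
have linj : injective l by move=> i j eq; apply: (dp i j (l i)); rewrite ?lp // eq lp.
have hinj : injective h by move=> i j eq; apply: (dq i j (h i)); rewrite ?hq' // eq hq'.
have lsurj s : s \in x |: S -> exists i, l i = s.
  have /eqP <- : [set l i | i : 'I_k] == x |: S.
    rewrite eqEcard card_imset // card_ord cx leqnn andbT.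
    by apply/subsetP=> _ /imsetP[i _ ->].
  by case/imsetP=> i _ ->; exists i.
have hsurj s : s \in y |: S -> exists i, h i = s.
  have /eqP <- : [set h i | i : 'I_k] == y |: S.
    rewrite eqEcard card_imset // card_ord cy leqnn andbT.
    by apply/subsetP=> _ /imsetP[i _ ->].
  by case/imsetP=> i _ ->; exists i.
(* The paths [p i] and [q j] meet [S] only at the end and at the start, respectively. So at a common
   vertex outside [S] one could switch from [p i] to [q j] and reach [B] avoiding both [S] and the
   arc [xy]. *)
have cross i j z : z \in p i -> z \in q j -> [/\ z = l i, z = h j & z \in S].
  move=> zp zq; case/path.splitPr: {2}_ / zp (erefl (p i)) => a1 a2 pi.
  case/path.splitPr: {2}_ / zq (erefl (q j)) => b1 b2 qj.
  have [hpi upi] := hp i; have [hqj uqj] := hq j.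
  have lastz : z \in S -> z = l i.
    by move=> zS; have [i' li] := lsurj z (setU1r x zS);
       rewrite -li (dp i i' z) // ?pi ?mem_cat ?mem_head ?orbT // -li lp.
  have headz : z \in S -> z = h j.
    by move=> zS; have [j' hj] := hsurj z (setU1r y zS);
       rewrite -hj (dq j j' z) // ?qj ?mem_cat ?mem_head ?orbT // -hj hq'.
  suff zS : z \in S by split; auto.
  have /sepS/hasP[w] : ABpath e1 A B (a1 ++ z :: b2).
    apply: (@ABpath_cat _ _ _ [set z] [set z]).
      by apply: (ABpath_prefix (B := x |: S) (s2 := a2)); rewrite -?pi ?inE.
    by apply: (ABpath_suffix (A := y |: S) (s1 := b1)); rewrite -?qj ?inE.
  rewrite mem_cat inE => /or3P[wa|/eqP-> //|wb] /= wS.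
    have [i' li] := lsurj w (setU1r x wS).
    have ii : i' = i by apply: (dp i' i w); rewrite -?li ?lp // li pi mem_cat wa.
    have := pE i; rewrite -ii li ii pi => -[eq _].
    move: upi; rewrite pi cat_uniq => /and3P[_ /hasPn na _].
    have : last w (a1 ++ z :: a2) = w by rewrite eq last_rcons.
    rewrite last_cat /= => lw; have /na := mem_last z a2.
    by rewrite lw wa.
  have [j' hj] := hsurj w (setU1r y wS).
  have jj : j' = j by apply: (dq j' j w); rewrite -?hj ?hq' // hj qj mem_cat inE wb !orbT.
  have := qE j; rewrite -jj hj jj qj => -[eq _].
  move: uqj; rewrite qj; case: b1 eq {qj} => [|c b1] [-> _] //= .
  by rewrite mem_cat inE wb !orbT.
(* Paths are glued at equal ends in [S]; the path ending in [x] continues, through the arc [xy],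
   with the one starting in [y]. *)
have ex i : exists j, h j = if l i == x then y else l i.
  apply: hsurj; case: eqP => [_|/eqP lx]; first exact: setU11.
  by have := lS i; rewrite !inE (negPf lx) /= => ->; rewrite orbT.
have [j hj] := fin_all_exists ex.
have jinj : injective j.
  move=> i i' eq; have := hj i; rewrite eq hj.
  have nyl i1 : l i1 != x -> y <> l i1.
    by move=> lx yl; case/negP: yS; have := lS i1; rewrite -yl in lx *; rewrite !inE (negPf lx).
  case: (eqVneq (l i') x) => [li'|/nyl li']; case: (eqVneq (l i) x) => [li|/nyl li] //.
  - by move=> _; apply: linj; rewrite li li'.
  - by move/esym.
  - by move/linj.
pose r i := rcons (a i) (l i) ++ (if l i == x then h (j i) :: b (j i) else b (j i)).
have in_r i z : z \in r i -> z \in p i \/ z \in q (j i) /\ (l i != x -> z \in b (j i)).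
  rewrite /r mem_cat -(pE i).1 => /orP[zp|zq]; [by left|right].
  by move: zq; rewrite (qE (j i)).1; case: eqP => // _; rewrite inE => ->; rewrite orbT.
have bh i : h i \notin b i by have [_] := hq i; rewrite (qE i).1 => /andP[].
have rdisj i i' z : z \in p i -> z \in q (j i') /\ (l i' != x -> z \in b (j i')) -> False.
  move=> zp [zq zb]; have [zl zh zS] := cross _ _ _ zp zq.
  have := hj i'; rewrite -zh; case: eqP zb => [_ _ zy|_ zb _].
    by case/negP: yS; rewrite -zy.
  by case/negP: (bh (j i')); rewrite -zh zb.
exists r; split=> [i|i i' z /in_r[zp|zq] /in_r[zp'|zq']].
- split.
    have hp1 := sub1 _ _ _ (hp i).1; have hq1 := sub1 _ _ _ (hq (j i)).1.
    rewrite (pE i).1 in hp1; rewrite (qE (j i)).1 in hq1.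
    rewrite /r; case: eqP (hj i) => [lx hy|_ hl].
      by apply: (ABpath_cat2 _ hp1 hq1); rewrite lx hy.
    by rewrite cat_rcons; apply: (ABpath_cat hp1); rewrite -hl; apply: hq1.
  rewrite /r cat_uniq -(pE i).1 (hp i).2 /=; apply/andP; split.
    apply/hasPn => z zq; apply/negP => /= zp; apply: (rdisj i i z zp).
    by rewrite (qE (j i)).1; move: zq; case: eqP => // _ zb; rewrite inE zb orbT.
  by have := (hq (j i)).2; rewrite (qE (j i)).1; case: eqP => // _ /andP[].
- exact: (dp _ _ z).
- by case: (rdisj _ _ _ zp zq').
- by case: (rdisj _ _ _ zp' zq).
- by apply: jinj; apply: (dq _ _ z); [case: zq|case: zq'].
Qed.

End Menger.

(** * Circuits, ears and disjoint paths in 3-connected graphs *)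

(** Reduces duplicate-freeness of rearranged lists to linear arithmetic: the occurrences of one
    vertex [z] are counted in all known duplicate-free lists and in the goal. *)
Ltac uniq_tac :=
  let z := fresh "z" in
  apply/uniq_countP => z;
  repeat match goal with H : is_true (uniq _) |- _ => move/uniq_countP: H => /(_ z) end;
  repeat match goal with H : ?P |- _ => match type of P with Prop => clear H end end;
  rewrite -?cats1 /= ?(count_cat, count_rev) /= ?(count_cat, count_rev) /= ; lia.

Section Edges.
Variable T : finType.
Implicit Types (s t : seq T) (x y : T).

Definition ed s : {set {set T}} := [set [set q.1; q.2] | q in steps s].

Lemma edP s e : reflect (exists u v, (u, v) \in steps s /\ e = [set u; v]) (e \in ed s).
Proof.
apply: (iffP imsetP) => [[[u v] uv ->]|[u [v [uv ->]]]]; first by exists u, v.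
by exists (u, v).
Qed.

Lemma ed_cat s x t : ed (s ++ x :: t) = ed (rcons s x) :|: ed (x :: t).
Proof.
apply/setP => e; rewrite inE; apply/edP/orP => [[u [v []]]|[]/edP[u [v [uv ->]]]].
- by rewrite steps_cat mem_cat => /orP[] uv ->; [left|right]; apply/edP; exists u, v.
- by exists u, v; rewrite steps_cat mem_cat uv.
- by exists u, v; rewrite steps_cat mem_cat uv orbT.
Qed.

Lemma ed_cons2 x y s : ed [:: x, y & s] = [set x; y] |: ed (y :: s).
Proof.
apply/setP => e; rewrite !inE; apply/edP/orP => [[u [v []]]|[/eqP->|/edP[u [v [uv ->]]]]].
- rewrite steps_cons2 inE => /orP[/eqP[-> ->] ->|uv ->]; first by left.
  by right; apply/edP; exists u, v.
- by exists x, y; rewrite steps_cons2 mem_head.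
- by exists u, v; rewrite steps_cons2 inE uv orbT.
Qed.

Lemma ed1 x : ed [:: x] = set0.
Proof. by apply/setP => e; rewrite inE; apply/edP => -[u [v []]]. Qed.

Lemma ed_rev s : ed (rev s) = ed s.
Proof.
apply/setP => e; apply/edP/edP => -[u [v [uv ->]]]; exists v, u; rewrite (setUC [set v]);
  split=> //; move: uv; rewrite steps_rev mem_rev.
  by case/mapP=> -[a b] ab [-> ->].
by move=> uv; apply/mapP; exists (u, v).
Qed.

Lemma ed_mem s (e : {set T}) x : e \in ed s -> x \in e -> x \in s.
Proof. by case/edP=> u [v [/mem_steps[us vs] ->]]; rewrite !inE => /orP[]/eqP->. Qed.

Lemma ed_catl s t : ed s \subset ed (s ++ t).
Proof.
case/lastP: s => [|s x]; first by apply/subsetP => e /edP[u [v []]].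
by rewrite cat_rcons ed_cat subsetUl.
Qed.

Lemma ed_catr s t : ed t \subset ed (s ++ t).
Proof.
case: t => [|x t]; first by apply/subsetP => e /edP[u [v []]].
by rewrite ed_cat subsetUr.
Qed.

Lemma walk_ed (e : rel T) s (x : {set T}) : walk e s -> x \in ed s -> x \in edgesG e.
Proof.
move/allP=> w /edP[u [v [uv ->]]]; apply/imsetP; exists (u, v) => //.
by rewrite inE; apply: w.
Qed.

End Edges.

Lemma edgesGP (T : finType) (g : rel T) e :
  reflect (exists u v, g u v /\ e = [set u; v]) (e \in edgesG g).
Proof.
apply: (iffP imsetP) => [[[u v]]|[u [v [uv ->]]]]; last by exists (u, v); rewrite ?inE.
by rewrite inE => uv ->; exists u, v.
Qed.

(** Cut at the last visit to [A], then at the first visit to [B] after it. *)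
Lemma ABpath_trim (T : finType) (e : rel T) (A B : {set T}) s :
  ABpath e A B s -> uniq s ->
  exists s', [/\ ABpath e A B s', uniq s', {subset s' <= s},
    ~~ has (mem A) (behead s') & forall p x, s' = rcons p x -> ~~ has (mem B) p].
Proof.
move=> h us; have hA : has (mem A) s.
  by case: s h {us} => // x p /andP[xA _]; rewrite /= xA.
have [s1 [x [s2 [es xA n2]]]] := split_has_last hA; subst s.
have h1 := ABpath_suffix h xA.
have hB : has (mem B) (x :: s2).
  by case/and3P: h1 => _ _ lB; apply/hasP; exists (last x s2); rewrite ?mem_last.
have [t1 [y [t2 [et yB n1]]]] := split_has hB.
rewrite et in h1; have h2 := ABpath_prefix h1 yB.
exists (rcons t1 y); split=> //.
- by move: us; rewrite et cat_uniq -cat_rcons cat_uniq => /and3P[_ _ /and3P[]].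
- by move=> z zt; rewrite et -cat_rcons !mem_cat zt !orbT.
- apply: contra n2 => /hasP[z zt zA]; apply/hasP; exists z => //.
  by case: t1 et {h1 h2 n1} zt => [|a t1] //= [_ ->]; rewrite -cat_rcons mem_cat => ->.
- by move=> p z /rcons_inj[<- _].
Qed.

Section Circuits.
Variables (T : finType) (g : rel T).
Hypotheses (g_sym : symmetric g) (g_irr : irreflexive g).

Lemma circuit_walk x p : walk g (x :: rcons p x) -> uniq (x :: p) -> 1 < size p ->
  circuitG g (ed (x :: rcons p x)).
Proof.
move=> w up sp; exists (x :: p); split=> //.
  by rewrite /= -walk_path.
apply/setP => e; apply/edP/imsetP => [[u [v [uv ->]]]|[u us ->]].
  by move: uv; rewrite next_steps // => /andP[us /eqP->]; exists u.
by exists u, (next (x :: p) u); rewrite next_steps // us eqxx.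
Qed.

(** Run along [a] and back along [b]. The size condition excludes that both paths are the single
    edge [st]. *)
Lemma theta_circuit s t a b : walk g (s :: rcons a t) -> walk g (s :: rcons b t) ->
  uniq (s :: t :: a ++ b) -> 0 < size a + size b ->
  circuitG g (ed (s :: rcons a t) :|: ed (s :: rcons b t)).
Proof.
move=> wa wb u sz.
have -> : ed (s :: rcons a t) :|: ed (s :: rcons b t) =
    ed (s :: rcons (a ++ t :: rev b) s).
  rewrite rcons_cat rcons_cons -rev_cons -cat_cons ed_cat -(ed_rev (s :: rcons b t)).
  by rewrite rev_cons rev_rcons rcons_cons rev_cons.
apply: circuit_walk.
- rewrite rcons_cat rcons_cons -rev_cons -cat_cons walk_cat rcons_cons wa /=.
  by rewrite -rev_rcons walk_rev.
- uniq_tac.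
- by rewrite size_cat /= size_rev; lia.
Qed.

End Circuits.

(** * Linkages, ears and thetas from 3-connectedness *)

Section Connected3.
Variables (T : finType) (g : rel T).
Hypotheses (g_sym : symmetric g) (g_irr : irreflexive g) (g3 : k_connected 3 g).

Lemma connected_avoid (S : {set T}) x y : #|S| < 3 -> x \notin S -> y \notin S ->
  exists p, [/\ walk g (x :: p), last x p = y, ~~ has (mem S) (x :: p) & uniq (x :: p)].
Proof.
move=> cS xS yS; have [_ /(_ S cS x y)] := g3; rewrite !inE => /(_ xS yS).
case/connectP => p pp ->; case/shortenP: pp => p' pp' up' _.
exists p'; split=> //.
  by rewrite walk_path; apply: sub_path pp' => u v /and3P[].
apply/hasPn => z; rewrite inE => /orP[/eqP->|zp] //=.
have: {in p', forall z, z \notin S}.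
  elim: p' x pp' {xS up' zp} => // a p' IH x /= /andP[/and3P[_ _]]; rewrite inE => aS pp z'.
  by rewrite inE => /orP[/eqP->|/(IH _ pp)].
by apply.
Qed.

(** The second vertex of a path that leaves [x], avoids [S :\ x] and ends outside [x |: S]. For sets
    of two vertices this is minimum degree 3. *)
Lemma nbr_avoid (S : {set T}) x : #|S| < 3 -> exists y, g x y && (y \notin S).
Proof.
move=> cS; have cS' : #|S :\ x| < 3 by apply: leq_ltn_trans cS; rewrite subset_leq_card ?subsetDl.
have [y] : exists y, y \notin x |: S.
  apply: NNPP => n; have: #|T| <= #|x |: S|.
    apply: subset_leq_card; apply/subsetP => y _; apply: contraT => ny.
    by case: n; exists y.
  by rewrite cardsU1; have [] := g3; case: (x \notin S) => /=; lia.
rewrite !inE negb_or => /andP[yx yS].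
have [||p [w lp n _]] := @connected_avoid (S :\ x) x y cS'; rewrite ?inE ?eqxx //.
  by rewrite (negPf yS) andbF.
case: p w lp n => [_ /= xy|a p]; first by rewrite xy eqxx in yx.
rewrite walk_cons2 => /andP[xa _] _ /norP[_ /norP[na _]].
exists a; rewrite xa; move: na; rewrite /= !inE negb_and negbK => /orP[/eqP ax|//].
by rewrite ax g_irr in xa.
Qed.

(** Menger's condition holds because fewer than [k] vertices miss some vertex of [A] and some vertex
    of [B], and leave them connected. Trimming makes the paths meet [A] and [B] only at their
    ends. *)
Lemma disjoint_paths3 k (A B : {set T}) : k <= 3 -> k <= #|A| -> k <= #|B| ->
  exists p : 'I_k -> seq T, [/\ disjoint_paths g A B p,
    forall i, ~~ has (mem A) (behead (p i)) &
    forall i q x, p i = rcons q x -> ~~ has (mem B) q].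
Proof.
move=> k3 kA kB.
have [S sep|p [hp dp]] := @menger _ g A B k.
  rewrite leqNgt; apply/negP => Sk.
  have ex (C : {set T}) : k <= #|C| -> exists2 a, a \in C & a \notin S.
    move=> kC; apply: NNPP => n; suff: #|C| <= #|S| by lia.
    apply: subset_leq_card; apply/subsetP => a aC; apply: contraT => aS.
    by case: n; exists a.
  have [[a aA aS] [b bB bS]] := (ex A kA, ex B kB).
  have [|q [w lq /negP n _]] := @connected_avoid S a b _ aS bS; first by lia.
  by apply/n/sep; rewrite /ABpath aA w lq bB.
have /fin_all_exists[p' hp'] i := ABpath_trim (hp i).1 (hp i).2.
exists p'; split=> [|i|i]; try by case: (hp' i).
split=> [i|i j x xi xj]; first by case: (hp' i).
have [[_ _ si _ _] [_ _ sj _ _]] := (hp' i, hp' j).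
by apply: (dp i j x); [apply: si|apply: sj].
Qed.

(** Two disjoint paths from the ends of [pq] to [U], joined by [pq], form the ear. If [m] is empty,
    the ear is [pq] itself. *)
Lemma ear (U : {set T}) p q : g p q -> 1 < #|U| ->
  exists s m t, [/\ (s \in U) && (t \in U), walk g (s :: rcons m t),
    uniq (s :: rcons m t), ~~ has (mem U) m & [set p; q] \in ed (s :: rcons m t)].
Proof.
move=> gpq cU; have pq : p != q by apply: contraTneq gpq => ->; rewrite g_irr.
have [w [[hw dw] _ tw]] : exists w : 'I_2 -> seq T, [/\ disjoint_paths g [set p; q] U w,
    forall i, ~~ has (mem [set p; q]) (behead (w i)) &
    forall i q x, w i = rcons q x -> ~~ has (mem U) q].
  by apply: disjoint_paths3; rewrite ?cards2 ?pq.
pose i0 : 'I_2 := ord0; pose i1 : 'I_2 := lift ord0 ord0.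
have [[h0 u0] [h1 u1]] := (hw i0, hw i1).
have [a [s [e0 sU]]] := ABpath_rconsE h0; have [b [t [e1 tU]]] := ABpath_rconsE h1.
have [x [a' [e0' xpq]]] := ABpath_consE h0; have [y [b' [e1' ypq]]] := ABpath_consE h1.
have dj z : z \in w i0 -> z \in w i1 -> False by move=> z0 z1; have := dw _ _ _ z0 z1.
have xy : x != y by apply/eqP => xy; apply: (dj x); rewrite ?e0' ?e1' ?xy mem_head.
have pqxy : [set p; q] = [set x; y].
  apply/eqP; rewrite eq_sym eqEcard !cards2 xy pq leqnn andbT.
  by apply/subsetP => z; rewrite !inE => /orP[]/eqP->; [move: xpq|move: ypq]; rewrite !inE.
have gxy : g x y.
  move: xpq ypq xy; rewrite !inE => /orP[]/eqP-> /orP[]/eqP->; rewrite ?eqxx //.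
  by rewrite g_sym.
have eW : s :: rcons (rev a ++ b) t = rev (w i0) ++ w i1.
  by rewrite e0 e1 rev_rcons cat_cons rcons_cat.
exists s, (rev a ++ b), t; rewrite eW; split=> //.
- by rewrite sU tU.
- rewrite e0' e1' rev_cons walk_cat walk_rcons2 -rev_cons walk_rev // gxy -e0' -e1' andbT.
  by case: (w i0) (w i1) h0 h1 => [|? ?] [|? ?] // /and3P[_ -> _] /and3P[_ -> _].
- rewrite cat_uniq rev_uniq u0 u1 andbT /=.
  by apply/hasPn => z z1; rewrite /= mem_rev; apply/negP => /dj; apply.
- by rewrite has_cat has_rev negb_or (tw _ _ _ e0) (tw _ _ _ e1).
- rewrite pqxy e0' e1' rev_cons -cats1 -catA /= ed_cat inE; apply/orP; right.
  by rewrite ed_cons2 setU11.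
Qed.

(** The paths come from two disjoint paths between the neighbours of [p] and those of [q] in the
    graph without [p] and [q]. If at most one vertex separated these sets, a path from another
    neighbour of [p] to [q], avoiding [p] and this vertex, would give a contradiction. *)
Lemma edge_theta p q : g p q -> exists P Q,
  [/\ walk g (p :: rcons P q), walk g (p :: rcons Q q), uniq (p :: q :: P ++ Q),
      0 < size P & 0 < size Q].
Proof.
move=> gpq; have pq : p != q by apply: contraTneq gpq => ->; rewrite g_irr.
pose g' := [rel u v | [&& g u v, u \notin [set p; q] & v \notin [set p; q]]].
pose A := [set u | g p u] :\ q; pose B := [set u | g q u] :\ p.
have [S sep|w [hw dw]] := @menger _ g' A B 2.
  rewrite leqNgt; apply/negP => S1.
  pose S' := p |: (S :\ q).
  have cS' : #|S'| < 3.
    rewrite cardsU1; have: #|S :\ q| <= #|S| by rewrite subset_leq_card ?subsetDl.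
    by case: (p \notin _) => /=; lia.
  have [|a /andP[ga aS]] := @nbr_avoid (q |: S :\ p) p.
    have: #|S :\ p| <= #|S| by rewrite subset_leq_card ?subsetDl.
    by rewrite cardsU1; case: (q \notin _) => /=; lia.
  have ap : a != p by apply: contraTneq ga => ->; rewrite g_irr.
  move: aS; rewrite !inE negb_or negb_and ap /= => /andP[aq aS].
  have [||c [wc lc nc uc]] := @connected_avoid S' a q cS'.
  - by rewrite !inE (negPf ap) (negPf aS) andbF.
  - by rewrite !inE eqxx eq_sym (negPf pq).
  case/lastP: c wc lc nc uc => [_ /= lq|c q' wc]; first by rewrite lq eqxx in aq.
  rewrite last_rcons => eq; rewrite {q'}eq in wc * => nc uc.
  have qc : q \notin a :: c by move: uc; rewrite -rcons_cons rcons_uniq => /andP[].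
  have pc : p \notin a :: c.
    apply: contra nc => pc; apply/hasP; exists p; last exact: setU11.
    by rewrite -rcons_cons mem_rcons inE pc orbT.
  have /sep/hasP[z zc /= zS] : ABpath g' A B (a :: c).
    case/lastP: c wc qc pc {nc uc} => [|c b].
      by rewrite walk_cons2 => /andP[gaq _] _ _; rewrite /= !inE aq ap ga g_sym gaq.
    rewrite -!rcons_cons walk_rcons2 => /andP[w gbq] qc pc.
    rewrite /ABpath rcons_cons last_rcons !inE aq ga g_sym gbq !andbT /=.
    apply/andP; split; last by rewrite (memPn pc) // mem_rcons mem_head.
    apply/allP => -[u v] uv /=; have [uc vc] := mem_steps uv.
    rewrite -rcons_cons in uv uc vc; rewrite (allP w _ uv) !inE !negb_or.
    by rewrite (memPn qc _ uc) (memPn qc _ vc) (memPn pc _ uc) (memPn pc _ vc).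
  case/negP: nc; apply/hasP; exists z; first by rewrite -rcons_cons mem_rcons inE zc orbT.
  by rewrite /= !inE zS (memPn qc) // orbT.
pose i0 : 'I_2 := ord0; pose i1 : 'I_2 := lift ord0 ord0.
have sub i : exists x m, [/\ w i = x :: m, walk g (p :: rcons (x :: m) q),
    p \notin w i & q \notin w i].
  have [h u] := hw i; case: (w i) h {u} => // x m /and3P[]; rewrite !inE => /andP[xq px] wm.
  move=> /andP[lp ql]; exists x, m.
  have av z : z \in x :: m -> (z != p) && (z != q).
    rewrite inE => /orP[/eqP->|zm]; last first.
      move: wm; rewrite walk_path => wm.
      case/splitPr: zm wm => m1 m2; rewrite cat_path /= !inE => /and3P[_ /and3P[_ _]].
      by rewrite negb_or.
    by rewrite xq andbT; apply: contraTneq px => ->; rewrite g_irr.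
  have [py qy] : p \notin x :: m /\ q \notin x :: m.
    by split; apply/negP => /av; rewrite eqxx ?andbF.
  split=> //; rewrite rcons_cons walk_cons2 px /= -rcons_cons lastI walk_rcons2.
  rewrite -lastI (g_sym _ q) ql andbT; apply: sub_all wm => -[u v] /=; by case/and3P.
have [x0 [m0 [e0 w0 p0 q0]]] := sub i0; have [x1 [m1 [e1 w1 p1 q1]]] := sub i1.
have [[_ u0] [_ u1]] := (hw i0, hw i1).
exists (x0 :: m0), (x1 :: m1); split=> //.
rewrite -e0 -e1 /= cat_uniq u0 u1 !inE !mem_cat !negb_or pq p0 q0 p1 q1 !andbT /=.
by apply/hasPn => z z1; apply/negP => /= z0; have := dw _ _ _ z0 z1.
Qed.

End Connected3.

(** * Circuits of the image graph *)

Section ImageCircuits.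
Local Open Scope fset_scope.
Variables (V : choiceType) (e : rel V).
Implicit Types (D N : {fset V} -> Prop) (u v w : V) (x y z : {fset V}).

Lemma circuit_rot D v : circuitG' e D ->
  (forall x, D x -> v \notin x) \/
  exists s, [/\ uniq (v :: s), 1 < size s & forall x, D x <->
    exists u w, (u, w) \in steps (v :: rcons s v) /\ x = [fset u; w]].
Proof.
case=> s [us ss _ sD]; have [vs|vs] := boolP (v \in s); [right|left]; last first.
  move=> x /sD[y ys ->]; apply: contra vs; rewrite !inE => /orP[]/eqP-> //.
  by rewrite mem_next.
have [i s' es] := rot_to vs; exists s'; rewrite -es rot_uniq us; split=> // [|x].
  by move: ss; rewrite -(size_rot i) es /=; lia.
have us' : uniq (v :: s') by rewrite -es rot_uniq.
split=> [/sD[y ys ->]|[u [w []]]].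
  by exists y, (next s y); rewrite next_steps // -es mem_rot ys next_rot ?eqxx.
by rewrite next_steps // -es mem_rot next_rot // => /andP[us1 /eqP->] ->; apply/sD; exists u.
Qed.

Lemma circuit_deg D v : circuitG' e D ->
  (forall x, D x -> v \notin x) \/
  exists x1 x2, [/\ x1 <> x2, D x1 /\ v \in x1, D x2 /\ v \in x2 &
    forall x, D x -> v \in x -> x = x1 \/ x = x2].
Proof.
case/(circuit_rot v) => [|[[|b s] [us ss sD]]]; [by left|by []|right].
case/lastP: s us ss sD => // s c us _ sD.
have [vb vc bc] : [/\ v != b, v != c & b != c].
  move: us => /= /and3P[]; rewrite !inE mem_rcons !inE !negb_or.
  by case/and3P=> -> -> _; rewrite mem_rcons inE negb_or => /andP[-> _].
have vs : v \notin b :: rcons s c by case/andP: us.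
exists [fset v; b], [fset v; c]; split.
- by move/fsetP/(_ b); rewrite !inE eqxx orbT eq_sym (negPf vb) (negPf bc).
- by rewrite !inE eqxx; split=> //; apply/sD; exists v, b; rewrite mem_head.
- rewrite !inE eqxx; split=> //; apply/sD; exists c, v.
  rewrite (fsetUC [fset v]); split=> //.
  by rewrite rcons_cons -!rcons_cons steps_rcons2 mem_rcons mem_head.
- move=> x /sD[u [w [+ ->]]].
  rewrite rcons_cons -!rcons_cons steps_rcons2 mem_rcons inE rcons_cons steps_cons2 inE.
  case/or3P=> [/eqP[-> ->]|/eqP[-> ->]|uw]; [by right; rewrite fsetUC|by left|].
  have [ui wi] := mem_steps uw; rewrite !inE => /orP[]/eqP vE;
    by case/negP: vs; rewrite vE.
Qed.

Lemma circuit_deg2 D v x : circuitG' e D -> D x -> v \in x ->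
  exists y, [/\ D y, v \in y & y <> x].
Proof.
move=> /(circuit_deg v)[h /h/negP //|[x1 [x2 [n [d1 v1] [d2 v2] h]]]] dx vx.
by case: (h _ dx vx) => ->; [exists x2|exists x1]; split=> // /esym.
Qed.

Lemma circuit_deg3 D v x y z : circuitG' e D -> D x -> D y -> D z ->
  v \in x -> v \in y -> v \in z -> x <> y -> z = x \/ z = y.
Proof.
move=> /(circuit_deg v)[h /h/negP //|[x1 [x2 [_ _ _ h]]]] dx dy dz vx vy vz.
by case: (h _ dx vx) (h _ dy vy) (h _ dz vz) => -> [] -> [] -> //; auto.
Qed.

Lemma steps_conn N (s : seq V) :
  (forall u v w, (u, v) \in steps s -> (v, w) \in steps s ->
     N [fset u; v] <-> N [fset v; w]) ->
  forall p q, p \in steps s -> q \in steps s -> N [fset p.1; p.2] -> N [fset q.1; q.2].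
Proof.
case: s => // x [|y s] // h.
suff H q : q \in steps [:: x, y & s] -> N [fset x; y] <-> N [fset q.1; q.2].
  by move=> p q /H hp /H hq /hp/hq.
elim: s x y h q => [|z s IH] x y h q; rewrite steps_cons2 inE; first by move/eqP->.
case/orP=> [/eqP->//|hq]; rewrite (h x y z) ?steps_cons2 ?inE ?eqxx ?orbT //.
apply: IH hq => u v w uv vw; apply: h; rewrite steps_cons2 inE ?uv ?vw orbT //.
Qed.

(** Connectedness of a circuit as an induction principle on its edges: [N] spreads through shared
    vertices. *)
Lemma circuit_conn D N : circuitG' e D ->
  (forall v x y, D x -> D y -> v \in x -> v \in y -> N x -> N y) ->
  forall x y, D x -> N x -> D y -> N y.
Proof.
move=> cD h x y dx nx dy.
have [v vx] : exists v, v \in x.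
  by case: cD => s [_ _ _ /(_ x)[/(_ dx)[v _ ->] _]]; exists v; rewrite !inE eqxx.
have [/(_ _ dx)|[s [us _ sD]]] := circuit_rot v cD; first by rewrite vx.
have [[u [w [uw ex]]] [u' [w' [uw' ey]]]] := (iffLR (sD x) dx, iffLR (sD y) dy).
subst; apply: (steps_conn _ uw uw' nx) => u1 v1 w1 h1 h2.
have d1 : D [fset u1; v1] by apply/sD; exists u1, v1.
have d2 : D [fset v1; w1] by apply/sD; exists v1, w1.
by split; apply: (h v1) => //; rewrite !inE eqxx ?orbT.
Qed.

(** Deleting its edges at [a] leaves the circuit unchanged or turns it into a path, so [N] need only
    spread between edges that avoid [a]. *)
Lemma circuit_conn_avoid D N a : circuitG' e D ->
  (forall v x y, D x -> D y -> a \notin x -> a \notin y -> v \in x -> v \in y -> N x -> N y) ->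
  forall x y, D x -> a \notin x -> N x -> D y -> a \notin y -> N y.
Proof.
move=> cD h x y dx ax nx dy ay.
have [na|[s [us _ sD]]] := circuit_rot a cD.
  apply: (circuit_conn cD _ dx nx dy) => v x1 y1 d1 d2.
  exact: (h v x1 y1 d1 d2 (na _ d1) (na _ d2)).
have [[u [w [uw ex]]] [u' [w' [uw' ey]]]] := (iffLR (sD x) dx, iffLR (sD y) dy).
have sub p : p \in steps s -> p \in steps (a :: rcons s a).
  case: s {us sD uw uw'} => // b s; rewrite rcons_cons steps_cons2 inE => ps.
  by rewrite -rcons_cons; case/lastP: s ps => [//|s c] ps;
     rewrite -!rcons_cons steps_rcons2 mem_rcons inE rcons_cons ps !orbT.
have in_s p q : (p, q) \in steps (a :: rcons s a) -> a \notin [fset p; q] -> (p, q) \in steps s.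
  case: (s) => [|b s1]; first by rewrite [rcons _ _]/= steps_cons2 mem_seq1 => /eqP[-> ->];
    rewrite !inE eqxx.
  rewrite rcons_cons steps_cons2 in_cons => /orP[/eqP[-> _]|]; first by rewrite !inE eqxx.
  case/lastP: s1 => [|s1 c]; first by rewrite [rcons _ _]/= steps_cons2 mem_seq1 => /eqP[_ ->];
    rewrite !inE eqxx orbT.
  rewrite -!rcons_cons steps_rcons2 mem_rcons in_cons => /orP[/eqP[_ ->]|//].
  by rewrite !inE eqxx orbT.
subst; apply: (@steps_conn N s _ _ _ (in_s _ _ uw ax) (in_s _ _ uw' ay) nx) => u1 v1 w1 h1 h2.
have d1 : D [fset u1; v1] by apply/sD; exists u1, v1; split=> //; apply: sub.
have d2 : D [fset v1; w1] by apply/sD; exists v1, w1; split=> //; apply: sub.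
have as_ : a \notin s by case/andP: us.
have na p q : (p, q) \in steps s -> a \notin [fset p; q].
  by case/mem_steps=> ps qs; rewrite !inE negb_or; apply/andP; split;
     apply: contraNneq as_ => ->.
by split; apply: (h v1) => //; rewrite ?na // !inE eqxx ?orbT.
Qed.

(** At a vertex of the smaller circuit both circuits have two edges, hence the same ones;
    connectedness does the rest. *)
Lemma circuit_sub D1 D2 : circuitG' e D1 -> circuitG' e D2 ->
  (forall x, D1 x -> D2 x) -> forall x, D2 x -> D1 x.
Proof.
move=> c1 c2 h x dx.
have [x0 d0] : exists x0, D1 x0.
  case: c1 => -[|v s] [_ ss _ sD] //; exists [fset v; next (v :: s) v]; apply/sD.
  by exists v; rewrite ?mem_head.
apply: (circuit_conn c2 _ (h _ d0) d0 dx) => v y z _ dz vy vz d1y.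
have [w [dw vw wy]] := circuit_deg2 c1 d1y vy.
by have [->|->] := circuit_deg3 c2 (h _ d1y) (h _ dw) dz vy vw vz (nesym wy).
Qed.

(* At every vertex the degrees 0 or 2 of the three circuits force an even number of edges
   common to all three, so these common edges fill a circuit as soon as there is one. *)
Lemma circuit_theta D1 D2 D3 a :
  circuitG' e D1 -> circuitG' e D2 -> circuitG' e D3 ->
  (forall x, D1 x -> D2 x \/ D3 x) -> (forall x, D2 x -> D1 x \/ D3 x) ->
  (forall x, D3 x -> D1 x \/ D2 x) -> D1 a -> D2 a -> D3 a ->
  forall x, D1 x -> D2 x /\ D3 x.
Proof.
move=> c1 c2 c3 h1 h2 h3 a1 a2 a3 x dx.
apply: (circuit_conn (N := fun x => D2 x /\ D3 x) c1 _ a1 (conj a2 a3) dx).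
move=> v y z d1y d1z vy vz [d2y d3y].
have [<- //|/eqP yz] := eqVneq y z.
(* [z], [w2] and [w3] are the second edges at [v] of the three circuits. Each of them lies in a
   second circuit too, which forces all three to be equal. *)
have [w2 [d2w vw2 n2]] := circuit_deg2 c2 d2y vy.
have [w3 [d3w vw3 n3]] := circuit_deg2 c3 d3y vy.
have at1 (w : {fset V}) : D1 w -> v \in w -> w <> y -> w = z.
  by move=> dw vw n; case: (circuit_deg3 c1 d1y d1z dw vy vz vw yz).
have at2 (w : {fset V}) : D2 w -> v \in w -> w <> y -> w = w2.
  by move=> dw vw n; case: (circuit_deg3 c2 d2y d2w dw vy vw2 vw (nesym n2)).
have at3 (w : {fset V}) : D3 w -> v \in w -> w <> y -> w = w3.
  by move=> dw vw n; case: (circuit_deg3 c3 d3y d3w dw vy vw3 vw (nesym n3)).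
case: (h1 _ d1z) => [d2z|d3z].
  have e2 := at2 _ d2z vz (nesym yz).
  case: (h3 _ d3w) => [d1w|d2w'].
    by have := at1 _ d1w vw3 n3 => e1; subst w3.
  by have := at2 _ d2w' vw3 n3 => e1; subst w2 w3.
have e3 := at3 _ d3z vz (nesym yz).
case: (h2 _ d2w) => [d1w|d3w'].
  by have := at1 _ d1w vw2 n2 => e1; subst w2.
by have := at3 _ d3w' vw2 n2 => e1; subst w2 w3.
Qed.

Lemma circuit_three D : circuitG' e D ->
  exists x y z, [/\ D x, D y, D z & [/\ x <> y, y <> z & x <> z]].
Proof.
move=> cD; have [v [x dx vx]] : exists v, exists2 x, D x & v \in x.
  case: (cD) => -[|v s] [_ ss _ sD] //; exists v, [fset v; next (v :: s) v].
    by apply/sD; exists v; rewrite ?mem_head.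
  by rewrite !inE eqxx.
have [/(_ _ dx)|[[|b [|c s]] [us // _ sD]]] := circuit_rot v cD; first by rewrite vx.
have d1 : D [fset v; b] by apply/sD; exists v, b; rewrite mem_head.
have d2 : D [fset b; c].
  by apply/sD; exists b, c; rewrite !rcons_cons !steps_cons2 !inE eqxx orbT.
have v1 : v \in [fset v; b] by rewrite !inE eqxx.
have v2 : v \notin [fset b; c].
  by move: us; rewrite /= !inE !negb_or => /andP[/and3P[-> -> _] _].
have [z [dz vz zn]] := circuit_deg2 cD d1 v1.
exists [fset v; b], [fset b; c], z; split=> //; split=> eq.
- by rewrite -eq v1 in v2.
- by rewrite eq vz in v2.
- by rewrite eq in zn.
Qed.

End ImageCircuits.

(** * Ears of thetas *)

Section Transfer.
Variables (T : finType) (g : rel T).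
Hypotheses (g_sym : symmetric g) (g_irr : irreflexive g) (g3 : k_connected 3 g).
Variables (V : choiceType) (e' : rel V) (f : {set T} -> {fset V}).
Hypothesis f_circuit : forall C, circuitG g C ->
  circuitG' e' (fun x' => exists2 x, x \in C & f x = x').
Implicit Types (A B C Z : {set {set T}}) (P Q R a b m : seq T) (x y z : {set T}).

Definition img C (u : {fset V}) := exists2 x, x \in C & f x = u.

(** The value [f x = f y] lies in all three images: [x] is in the two circuits containing [A], and
    [y] is in the third. As any two of the images cover the remaining one, [circuit_theta]
    applies. *)
Lemma theta_transfer A B Z x y :
  circuitG g (A :|: B) -> circuitG g (A :|: Z) -> circuitG g (B :|: Z) ->
  x \in A -> y \in B -> f x = f y -> forall z, z \in A :|: B :|: Z ->
  [/\ img (A :|: B) (f z), img (A :|: Z) (f z) & img (B :|: Z) (f z)].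
Proof.
move=> cAB cAZ cBZ xA yB xy z zABZ.
have c1 := f_circuit cAB; have c2 := f_circuit cAZ; have c3 := f_circuit cBZ.
have i1 : img (A :|: B) (f x) by exists x => //; rewrite inE xA.
have i2 : img (A :|: Z) (f x) by exists x => //; rewrite inE xA.
have i3 : img (B :|: Z) (f x) by exists y => //; rewrite inE yB.
have h1 u : img (A :|: B) u -> img (A :|: Z) u \/ img (B :|: Z) u.
  by case=> w; rewrite inE => /orP[]wA <-; [left|right]; exists w; rewrite // inE wA.
have h2 u : img (A :|: Z) u -> img (A :|: B) u \/ img (B :|: Z) u.
  by case=> w; rewrite inE => /orP[]wA <-; [left|right]; exists w; rewrite // inE wA ?orbT.
have h3 u : img (B :|: Z) u -> img (A :|: B) u \/ img (A :|: Z) u.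
  by case=> w; rewrite inE => /orP[]wA <-; [left|right]; exists w; rewrite // inE wA ?orbT.
have [zAB|zZ] : z \in A :|: B \/ z \in A :|: Z.
  by move: zABZ; rewrite !inE => /orP[->|->]; [left|right; rewrite orbT].
  have iz : img (A :|: B) (f z) by exists z.
  by have [? ?] := circuit_theta c1 c2 c3 h1 h2 h3 i1 i2 i3 iz; split.
have iz : img (A :|: Z) (f z) by exists z.
have h3' u : img (B :|: Z) u -> img (A :|: Z) u \/ img (A :|: B) u.
  by case/h3; [right|left].
by have [? ?] := circuit_theta c2 c1 c3 h2 h1 h3' i2 i1 i3 iz; split.
Qed.

(** At most one of the three paths may be the bare edge [st], so that any two of them form a
    circuit. *)
Definition theta s t a b m :=
  [/\ walk g (s :: rcons a t), walk g (s :: rcons b t), walk g (s :: rcons m t),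
      uniq (s :: t :: a ++ b ++ m) &
      [&& 0 < size a + size b, 0 < size a + size m & 0 < size b + size m]].

Lemma theta_circuits s t a b m : theta s t a b m ->
  [/\ circuitG g (ed (s :: rcons a t) :|: ed (s :: rcons b t)),
      circuitG g (ed (s :: rcons a t) :|: ed (s :: rcons m t)) &
      circuitG g (ed (s :: rcons b t) :|: ed (s :: rcons m t))].
Proof.
by case=> wa wb wm u /and3P[sab sam sbm]; split; apply: theta_circuit => //; uniq_tac.
Qed.

Lemma theta_swap s t a b m : theta s t a b m -> theta s t b a m.
Proof.
by case=> wa wb wm u sz; split=> //; [uniq_tac|lia].
Qed.

Lemma theta_rot s t a b m : theta s t a b m -> theta s t b m a.
Proof.
by case=> wa wb wm u sz; split=> //; [uniq_tac|lia].
Qed.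

Lemma path_rev s t a : s :: rcons (rev a) t = rev (t :: rcons a s).
Proof. by rewrite rev_cons rev_rcons. Qed.

Lemma theta_rev s t a b m : theta s t a b m -> theta t s (rev a) (rev b) (rev m).
Proof.
by case=> wa wb wm u sz; split; rewrite ?path_rev ?walk_rev ?size_rev //; uniq_tac.
Qed.

Lemma theta_imgs s t a b m x y z : theta s t a b m ->
  x \in ed (s :: rcons a t) -> y \in ed (s :: rcons b t) -> f x = f y ->
  z \in ed (s :: rcons a t) :|: ed (s :: rcons b t) :|: ed (s :: rcons m t) ->
  [/\ img (ed (s :: rcons a t) :|: ed (s :: rcons b t)) (f z),
      img (ed (s :: rcons a t) :|: ed (s :: rcons m t)) (f z) &
      img (ed (s :: rcons b t) :|: ed (s :: rcons m t)) (f z)].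
Proof.
move=> /theta_circuits[c1 c2 c3] xA yB xy zABC.
exact: (theta_transfer c1 c2 c3 xA yB xy zABC).
Qed.

Lemma ed_sub_cat a b c : ed b \subset ed (a ++ b ++ c).
Proof. exact: subset_trans (ed_catl b c) (ed_catr a _). Qed.

(** With both interiors empty the two paths would be the same edge. *)
Lemma ed_size_gt0 s t a m z : z \in ed (s :: rcons m t) -> z \notin ed (s :: rcons a t) ->
  0 < size a + size m.
Proof. by case: a => [|? ?] //; case: m => [|? ?] //= ->. Qed.

(* An ear with both ends on the path [P], cutting off the piece [l2]. *)
Lemma ear_same_path s t P Q s1 t1 l1 l2 l3 m x y z :
  walk g (s :: rcons P t) -> walk g (s :: rcons Q t) -> walk g (s1 :: rcons m t1) ->
  uniq (s :: t :: P ++ Q ++ m) -> s :: rcons P t = l1 ++ s1 :: l2 ++ t1 :: l3 ->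
  0 < size P + size Q ->
  x \in ed (s1 :: rcons l2 t1) -> y \in ed (s :: rcons Q t) -> f x = f y ->
  z \in ed (s1 :: rcons m t1) -> z \notin ed (s :: rcons P t) -> z \notin ed (s :: rcons Q t) ->
  img (ed (s :: rcons P t) :|: ed (s :: rcons Q t)) (f z).
Proof.
move=> wP wQ wm u eL sz xl yQ xy zm zP zQ.
have eL' : s :: rcons P t = l1 ++ (s1 :: rcons l2 t1) ++ l3 by rewrite eL /= cat_rcons.
have [c1 eq1] : exists c, t1 :: l3 = rcons c t.
  exists (belast t1 l3); rewrite lastI; congr rcons.
  by have := congr1 (last s) eL; rewrite -rcons_cons last_rcons last_cat /= last_cat.
have [c2 eq2] : exists c, rcons l1 s1 = s :: c.
  by case: (l1) eL => [|a l] [-> _]; [exists [::]|exists (rcons l s1)].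
(* [r] is the rest of the circuit of [P] and [Q]: from [t1] to [t], back along [Q] to [s], and on to
   [s1]. With the piece [l2] and the ear [m] it forms a theta in which [x] and [y] lie on different
   paths. *)
pose r := l3 ++ rev Q ++ l1.
have er : t1 :: rcons r s1 = c1 ++ t :: rev Q ++ s :: c2.
  by rewrite -cat_rcons -eq1 -eq2 /r !rcons_cat.
have wP' := wP; rewrite eL walk_cat -cat_cons walk_cat rcons_cons in wP'.
case/and3P: wP' => wl1 wl2 wl3.
have wr : walk g (s1 :: rcons (rev r) t1).
  rewrite path_rev walk_rev // er walk_cat -eq1 wl3 -cat_cons walk_cat -eq2 wl1 andbT.
  by rewrite rcons_cons -rev_cons -rev_rcons walk_rev.
have subQ : ed (s :: rcons Q t) \subset ed (s1 :: rcons (rev r) t1).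
  rewrite path_rev ed_rev er -(ed_rev (s :: rcons Q t)) rev_cons rev_rcons.
  have -> : t :: rev Q ++ s :: c2 = rcons (t :: rev Q) s ++ c2 by rewrite cat_rcons.
  exact: ed_sub_cat.
have subl : ed (s1 :: rcons l2 t1) \subset ed (s :: rcons P t).
  by rewrite eL'; apply: ed_sub_cat.
have subr : ed (s1 :: rcons (rev r) t1) \subset ed (s :: rcons P t) :|: ed (s :: rcons Q t).
  rewrite path_rev ed_rev er ed_cat -eq1 -cat_cons ed_cat -eq2 rcons_cons.
  rewrite -rev_cons -rev_rcons ed_rev.
  have s3 : ed (t1 :: l3) \subset ed (s :: rcons P t).
    by rewrite eL -!cat_cons catA; apply: ed_catr.
  have s0 : ed (rcons l1 s1) \subset ed (s :: rcons P t).
    by rewrite eL -cat_rcons; apply: ed_catl.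
  by rewrite !subUset subsetUr (subset_trans s3 (subsetUl _ _)) (subset_trans s0 (subsetUl _ _)).
have uL : uniq ((s :: rcons P t) ++ Q ++ m) by uniq_tac.
rewrite eL in uL.
have zl : z \notin ed (s1 :: rcons l2 t1) by apply: contra zP; apply: (subsetP subl).
have zr : z \notin ed (s1 :: rcons (rev r) t1).
  by apply/negP => /(subsetP subr); rewrite inE (negPf zP) (negPf zQ).
have th : theta s1 t1 l2 (rev r) m.
  split=> //; first by rewrite /r; uniq_tac.
  rewrite addnC (ed_size_gt0 zm zl) addnC (ed_size_gt0 zm zr) !andbT.
  have := congr1 size eL; clear - sz.
  by rewrite /r /= !(size_cat, size_rev, size_rcons) /= !(size_cat, size_rev, size_rcons) /=; lia.
have yr := subsetP subQ _ yQ.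
have [|[v vin <-] _ _] := theta_imgs th xl yr xy (z := z); first by rewrite !inE zm orbT.
exists v => //; move: vin; rewrite inE => /orP[/(subsetP subl)|/(subsetP subr)//].
by rewrite inE => ->.
Qed.

(* An ear between interior vertices of [Q] and [R], turning the theta into a
   subdivision of K4. *)
Lemma ear_across s t P Q R n1 n2 q1 q2 r1 r2 m x y z :
  theta s t P Q R -> walk g (n1 :: rcons m n2) -> uniq (s :: t :: P ++ Q ++ R ++ m) ->
  Q = q1 ++ n1 :: q2 -> R = r1 ++ n2 :: r2 ->
  x \in ed (s :: rcons P t) -> y \in ed (s :: rcons q1 n1) -> f x = f y ->
  z \in ed (n1 :: rcons m n2) ->
  img (ed (s :: rcons P t) :|: ed (s :: rcons Q t)) (f z).
Proof.
case=> wP wQ wR _ _ wm u eQ eR xP yQ xy zm; subst.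
have eq : s :: rcons (q1 ++ n1 :: q2) t = (s :: q1) ++ n1 :: rcons q2 t by rewrite rcons_cat.
have er : s :: rcons (r1 ++ n2 :: r2) t = (s :: r1) ++ n2 :: rcons r2 t by rewrite rcons_cat.
have [wq1 wq2] : walk g (s :: rcons q1 n1) /\ walk g (n1 :: rcons q2 t).
  by move: wQ; rewrite eq walk_cat rcons_cons => /andP.
have [wr1 wr2] : walk g (s :: rcons r1 n2) /\ walk g (n2 :: rcons r2 t).
  by move: wR; rewrite er walk_cat rcons_cons => /andP.
have eb : s :: rcons (P ++ t :: rev q2) n1 = (s :: P) ++ t :: rcons (rev q2) n1.
  by rewrite rcons_cat.
have em : s :: rcons (r1 ++ n2 :: rev m) n1 = (s :: r1) ++ n2 :: rcons (rev m) n1.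
  by rewrite rcons_cat.
(* A theta between [s] and [n1]: the first piece of [Q]; [P] followed by the rest of [Q] backwards;
   the first piece of [R] followed by the ear backwards. These contain [y], [x] and [z], and the
   first two together are [P] and [Q]. *)
have th : theta s n1 q1 (P ++ t :: rev q2) (r1 ++ n2 :: rev m).
  split=> //.
  - by rewrite eb walk_cat rcons_cons wP path_rev walk_rev.
  - by rewrite em walk_cat rcons_cons wr1 path_rev walk_rev.
  - uniq_tac.
  - by clear; rewrite !size_cat /=; lia.
have xP' : x \in ed (s :: rcons (P ++ t :: rev q2) n1).
  by rewrite eb ed_cat inE rcons_cons xP.
have [|[v vin <-] _ _] := theta_imgs th yQ xP' (esym xy) (z := z).
  by rewrite em ed_cat path_rev ed_rev !inE zm !orbT.
exists v => //; move: vin; rewrite eq eb !ed_cat !rcons_cons path_rev ed_rev !inE.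
by case/or3P=> ->; rewrite ?orbT.
Qed.

(* All three circuits of the theta have the same image [D]. *)
Definition mono_theta s t P Q R (D : {fset V} -> Prop) :=
  [/\ theta s t P Q R,
     forall x, x \in ed (s :: rcons P t) :|: ed (s :: rcons Q t) :|: ed (s :: rcons R t) -> D (f x)
   & forall u, D u ->
     [/\ img (ed (s :: rcons P t) :|: ed (s :: rcons Q t)) u,
         img (ed (s :: rcons P t) :|: ed (s :: rcons R t)) u &
         img (ed (s :: rcons Q t) :|: ed (s :: rcons R t)) u]].

Lemma mono_swap s t P Q R D : mono_theta s t P Q R D -> mono_theta s t Q P R D.
Proof.
case=> th h1 h2; split; first exact: theta_swap.
  by move=> x; rewrite (setUC (ed (s :: rcons Q t))); apply: h1.
by move=> u /h2[i1 i2 i3]; split=> //; rewrite setUC.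
Qed.

Lemma mono_rot s t P Q R D : mono_theta s t P Q R D -> mono_theta s t Q R P D.
Proof.
case=> th h1 h2; split; first exact: theta_rot.
  by move=> x; rewrite setUC setUA; apply: h1.
by move=> u /h2[i1 i2 i3]; split=> //; rewrite setUC.
Qed.

Lemma mono_rev s t P Q R D : mono_theta s t P Q R D -> mono_theta t s (rev P) (rev Q) (rev R) D.
Proof.
case=> th h1 h2; split; first exact: theta_rev.
  by move=> x; rewrite !path_rev !ed_rev; apply: h1.
by move=> u /h2[i1 i2 i3]; split; rewrite !path_rev !ed_rev.
Qed.

Lemma ed_first (s t : T) a : exists x, x \in ed (s :: rcons a t).
Proof.
by case: a => [|b a]; [exists [set s; t]|exists [set s; b]]; rewrite ed_cons2 setU11.
Qed.

(** Let [x] be an edge of the piece [l2]. As [Q] and [R] also form a circuit with image [D], some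
    [y] on it has the same image as [x], and [ear_same_path] applies. *)
Lemma mono_ear_same s t P Q R D s1 t1 l1 l2 l3 m z :
  mono_theta s t P Q R D -> walk g (s1 :: rcons m t1) ->
  uniq (s :: t :: P ++ Q ++ R ++ m) -> s :: rcons P t = l1 ++ s1 :: l2 ++ t1 :: l3 ->
  z \in ed (s1 :: rcons m t1) -> z \notin ed (s :: rcons P t) ->
  z \notin ed (s :: rcons Q t) -> z \notin ed (s :: rcons R t) -> D (f z).
Proof.
case=> -[wP wQ wR _ /and3P[sPQ sPR _]] h1 h2 wm u eL zm zP zQ zR.
have [x xl] := ed_first s1 t1 l2.
have xP : x \in ed (s :: rcons P t).
  have -> : s :: rcons P t = l1 ++ (s1 :: rcons l2 t1) ++ l3 by rewrite eL /= cat_rcons.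
  exact: (subsetP (ed_sub_cat _ _ _)).
have [|_ _ [y +] xy] := h2 (f x); first by apply: h1; rewrite !inE xP.
rewrite inE => /orP[yQ|yR].
  have [|v + <-] := ear_same_path wP wQ wm _ eL sPQ xl yQ (esym xy) zm zP zQ.
    by uniq_tac.
  by rewrite inE => vin; apply: h1; rewrite !inE vin.
have [|v + <-] := ear_same_path wP wR wm _ eL sPR xl yR (esym xy) zm zP zR.
  by uniq_tac.
by rewrite inE => /orP[]vin; apply: h1; rewrite !inE vin ?orbT.
Qed.

(** An edge [x] of [P] shares its image with some edge [y] of [Q] or [R], since these two paths form
    a circuit with image [D]; [ear_across] applies to [x] and [y]. *)
Lemma mono_ear_across s t P Q R D s1 t1 m z :
  mono_theta s t P Q R D -> walk g (s1 :: rcons m t1) ->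
  uniq (s :: t :: P ++ Q ++ R ++ m) -> s1 \in Q -> t1 \in R ->
  z \in ed (s1 :: rcons m t1) -> D (f z).
Proof.
(* The case of [y] on the piece of [Q'] before the end of the ear. Reversing the theta and
   exchanging [Q] with [R] brings the other three positions of [y] to this one. *)
have half s' t' P' Q' R' n1 n2 q1 q2 m' x y : mono_theta s' t' P' Q' R' D ->
    walk g (n1 :: rcons m' n2) -> uniq (s' :: t' :: P' ++ Q' ++ R' ++ m') ->
    Q' = q1 ++ n1 :: q2 -> n2 \in R' -> x \in ed (s' :: rcons P' t') ->
    y \in ed (s' :: rcons q1 n1) -> f x = f y -> z \in ed (n1 :: rcons m' n2) -> D (f z).
  move=> [th h1 _] wm u eQ /splitPr eR xP yq xy zm; case: _ / eR th h1 u => r1 r2 th h1 u.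
  have [v vin <-] := ear_across th wm u eQ erefl xP yq xy zm.
  by apply: h1; rewrite inE vin.
move=> mt wm u s1Q t1R zm; have [_ h1 h2] := mt.
have [x xP] := ed_first s t P.
have [|_ _ [y yQR /esym xy]] := h2 (f x); first by apply: h1; rewrite !inE xP.
have xP' : x \in ed (t :: rcons (rev P) s) by rewrite path_rev ed_rev.
have wm' : walk g (t1 :: rcons (rev m) s1) by rewrite path_rev walk_rev.
have zm' : z \in ed (t1 :: rcons (rev m) s1) by rewrite path_rev ed_rev.
have mt' := mono_rot (mono_swap mt).
have [q1 [q2 eQ]] : exists q1 q2, Q = q1 ++ s1 :: q2 by case/splitPr: s1Q => q1 q2; exists q1, q2.
have [r1 [r2 eR]] : exists r1 r2, R = r1 ++ t1 :: r2 by case/splitPr: t1R => r1 r2; exists r1, r2.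
have eQ' : rev Q = rev q2 ++ s1 :: rev q1 by rewrite eQ rev_cat rev_cons cat_rcons.
have eR' : rev R = rev r2 ++ t1 :: rev r1 by rewrite eR rev_cat rev_cons cat_rcons.
have cQ : s :: rcons Q t = (s :: q1) ++ s1 :: rcons q2 t by rewrite eQ rcons_cat.
have cR : s :: rcons R t = (s :: r1) ++ t1 :: rcons r2 t by rewrite eR rcons_cat.
move: yQR; rewrite cQ cR !ed_cat !inE !rcons_cons => /orP[]/orP[] yin.
- by apply: (half _ _ _ _ _ _ _ _ _ _ _ _ mt wm u eQ t1R xP yin xy zm).
- apply: (half _ _ _ _ _ _ _ _ _ _ _ _ (mono_rev mt) wm _ eQ' _ xP' _ xy zm).
  + by uniq_tac.
  + by rewrite mem_rev.
  + by rewrite path_rev ed_rev.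
- apply: (half _ _ _ _ _ _ _ _ _ _ _ _ (mono_swap (mono_rot (mono_rot mt)))
    wm' _ eR _ xP yin xy zm') => //.
  by uniq_tac.
- apply: (half _ _ _ _ _ _ _ _ _ _ _ _ (mono_rev (mono_swap (mono_rot (mono_rot mt))))
    wm' _ eR' _ xP' _ xy zm').
  + by uniq_tac.
  + by rewrite mem_rev.
  + by rewrite path_rev ed_rev.
Qed.

Lemma mono_ear_in s t P Q R D s1 t1 m z :
  mono_theta s t P Q R D -> walk g (s1 :: rcons m t1) -> s1 != t1 ->
  uniq (s :: t :: P ++ Q ++ R ++ m) -> s1 \in s :: rcons P t -> t1 \in s :: rcons P t ->
  z \in ed (s1 :: rcons m t1) -> z \notin ed (s :: rcons P t) ->
  z \notin ed (s :: rcons Q t) -> z \notin ed (s :: rcons R t) -> D (f z).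
Proof.
move=> mt wm st u s1P t1P zm zP zQ zR.
case/splitPr eL: {-1}_ / s1P => [l1 l2].
have: t1 \in l1 ++ s1 :: l2 by rewrite -eL.
rewrite mem_cat inE eq_sym (negPf st) /= => /orP[]/splitPr eq.
  case: _ / eq eL => a b; rewrite -catA => eL.
  apply: (mono_ear_same (s1 := t1) (t1 := s1) (m := rev m) mt _ _ eL _ zP zQ zR).
  - by rewrite path_rev walk_rev.
  - by uniq_tac.
  - by rewrite path_rev ed_rev.
case: _ / eq eL => a b eL.
exact: (mono_ear_same mt wm u eL zm zP zQ zR).
Qed.

Lemma mono_theta_all s t P Q R D p q :
  mono_theta s t P Q R D -> g p q -> D (f [set p; q]).
Proof.
move=> mt gpq; have [th h1 _] := mt; have [_ _ _ u _] := th.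
have [|] := boolP ([set p; q] \in
  ed (s :: rcons P t) :|: ed (s :: rcons Q t) :|: ed (s :: rcons R t)); first exact: h1.
rewrite !inE !negb_or => /andP[/andP[zP zQ] zR].
pose U := [set x in s :: t :: P ++ Q ++ R].
have cU : 1 < #|U| by rewrite cardsE (card_uniqP u).
have [s1 [m [t1 [/andP[s1U t1U] wm um mU zm]]]] := ear g_sym g_irr g3 gpq cU.
have um' : uniq (s :: t :: P ++ Q ++ R ++ m).
  have -> : s :: t :: P ++ Q ++ R ++ m = (s :: t :: P ++ Q ++ R) ++ m by rewrite /= -!catA.
  rewrite cat_uniq u /=; apply/andP; split.
    apply: contra mU => /hasP[x xm /= xU]; apply/hasP; exists x => //=.
    by rewrite inE.
  by move: um; rewrite /= rcons_uniq => /and3P[_ _].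
have st : s1 != t1.
  by move: um; rewrite /= mem_rcons inE negb_or => /andP[/andP[]].
have mt2 := mono_rot mt; have mt3 := mono_rot mt2.
have [u2 u3] : uniq (s :: t :: Q ++ R ++ P ++ m) /\ uniq (s :: t :: R ++ P ++ Q ++ m).
  by split; uniq_tac.
have in3 (x : T) : x \in U -> [|| x == s, x == t, x \in P, x \in Q | x \in R].
  by rewrite !inE !mem_cat.
have mem a (x : T) : (x \in s :: rcons a t) = [|| x == s, x == t | x \in a].
  by rewrite inE mem_rcons inE.
have wm' : walk g (t1 :: rcons (rev m) s1) by rewrite path_rev walk_rev.
have zm' : [set p; q] \in ed (t1 :: rcons (rev m) s1) by rewrite path_rev ed_rev.
have [v1 [v2 v3]] : uniq (s :: t :: P ++ Q ++ R ++ rev m) /\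
   uniq (s :: t :: Q ++ R ++ P ++ rev m) /\ uniq (s :: t :: R ++ P ++ Q ++ rev m).
  by do 2?split; uniq_tac.
(* [A1] to [A3]: both ends of the ear on one path, the ends [s] and [t] included. The [B] and [C]
   families: ends inside two different paths, in either order. *)
have A1 := mono_ear_in mt wm st um' _ _ zm zP zQ zR.
have A2 := mono_ear_in mt2 wm st u2 _ _ zm zQ zR zP.
have A3 := mono_ear_in mt3 wm st u3 _ _ zm zR zP zQ.
have B1 := mono_ear_across mt wm um' _ _ zm.
have B2 := mono_ear_across mt2 wm u2 _ _ zm.
have B3 := mono_ear_across mt3 wm u3 _ _ zm.
have C1 := mono_ear_across mt wm' v1 _ _ zm'.
have C2 := mono_ear_across mt2 wm' v2 _ _ zm'.
have C3 := mono_ear_across mt3 wm' v3 _ _ zm'.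
rewrite !mem in A1 A2 A3.
case/or4P: (in3 _ s1U) => [h|h|h|/orP[h|h]]; case/or4P: (in3 _ t1U) => [k|k|k|/orP[k|k]];
  rewrite h k ?orbT in A1 A2 A3 B1 B2 B3 C1 C2 C3 *; auto.
Qed.

End Transfer.

(** * Injectivity *)

Section Arcs.
Variables (T : finType) (g : rel T).

Lemma closed_rot x p s : walk g (x :: rcons p x) -> s \in x :: p ->
  exists p', [/\ walk g (s :: rcons p' s), perm_eq (s :: p') (x :: p)
    & ed (s :: rcons p' s) = ed (x :: rcons p x)].
Proof.
move=> w; rewrite inE; case: eqVneq => [-> _|_ /= sp]; first by exists p.
case/splitPr: sp w => l1 l2; rewrite rcons_cat -cat_cons walk_cat => /andP[w1 w2].
exists (l2 ++ x :: l1); split.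
- by rewrite rcons_cat rcons_cons -cat_cons walk_cat; apply/andP.
- by rewrite -[s :: _ ++ _]/((s :: l2) ++ x :: l1) perm_catC.
- by rewrite rcons_cat !rcons_cons -cat_cons !ed_cat setUC.
Qed.

Lemma arcs x p s t : walk g (x :: rcons p x) -> s \in x :: p -> t \in x :: p -> s != t ->
  exists a b, [/\ walk g (s :: rcons a t), walk g (t :: rcons b s),
    perm_eq (s :: t :: a ++ b) (x :: p) &
    ed (x :: rcons p x) = ed (s :: rcons a t) :|: ed (t :: rcons b s)].
Proof.
move=> w sp tp st; have [p' [w' pe <-]] := closed_rot w sp.
have: t \in p' by move: tp; rewrite -(perm_mem pe) inE eq_sym (negPf st).
move/splitPr=> tp'; case: p' / tp' w' pe => a b w' pe; exists a, b.
move: w'; rewrite rcons_cat -cat_cons walk_cat ed_cat rcons_cons => /andP[-> ->].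
split=> //; apply: perm_trans pe; rewrite perm_cons.
by rewrite -[t :: a ++ b]/([:: t] ++ a ++ b) perm_catCA.
Qed.

Lemma close_path p q P : symmetric g -> g p q -> walk g (p :: rcons P q) ->
  walk g (p :: rcons (rcons P q) p) /\
  ed (p :: rcons (rcons P q) p) = ed (p :: rcons P q) :|: [set [set p; q]].
Proof.
move=> gs gpq w; split; first by rewrite -!rcons_cons walk_rcons2 rcons_cons w gs.
by rewrite -cats1 -cat_cons -rcons_cons cat_rcons ed_cat ed_cons2 ed1 setU0 (setUC [set q]).
Qed.

End Arcs.

(** * The number of edges of a forest *)

Section Forest.
Variables (T : finType) (h : rel T).
Hypotheses (h_sym : symmetric h) (h_irr : irreflexive h).
(** Size 1 is allowed: it is an edge run forth and back. *)
Hypothesis acyclic : forall x p, walk h (x :: rcons p x) -> uniq (x :: p) -> size p <= 1.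

(** Otherwise paths in [U] could be prolonged beyond [#|T|] vertices: the first vertex has a
    neighbour other than the second one, and it is new because no circuit can close. *)
Lemma forest_leaf (U : {set T}) : U != set0 ->
  exists2 v, v \in U & #|[set w in U | h v w]| <= 1.
Proof.
move=> /set0Pn[x0 x0U]; apply: NNPP => n.
have deg y v : v \in U -> exists w, [/\ w \in U, h v w & w != y].
  move=> vU; have : 1 < #|[set w in U | h v w]|.
    by rewrite ltnNge; apply/negP => le; apply: n; exists v.
  rewrite (cardsD1 y); move=> lt; have : 0 < #|[set w in U | h v w] :\ y| by lia.
  by case/card_gt0P => w; rewrite !inE => /and3P[wy wU vw]; exists w.
have long k : exists x p, [/\ size p = k, walk h (x :: p), uniq (x :: p) & {subset x :: p <= U}].
  elim: k => [|k [x [p [sp w u sU]]]].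
    by exists x0, [::]; split=> // z; rewrite inE => /eqP->.
  (* For [p] empty the default [x] of [head] is harmless: a neighbour of [x] differs from [x]
     anyway. *)
  have [v [vU xv vy]] := deg (head x p) x (sU x (mem_head _ _)).
  have vx : v != x by apply: contraTneq xv => ->; rewrite h_irr.
  have [vp|vp] := boolP (v \in p); last first.
    exists v, (x :: p); split=> //=; first by rewrite sp.
    - by rewrite walk_cons2 h_sym xv.
    - by rewrite inE negb_or vx vp.
    - by move=> z; rewrite inE => /orP[/eqP->|/sU].
  case: p sp w u sU vy vp => // y p sp w u sU /= vy; rewrite inE (negPf vy) /=.
  move/splitPr=> vp; case: p / vp sp w u sU => p1 p2 sp w u sU.
  have cw : walk h (x :: rcons (y :: rcons p1 v) x).
    rewrite !rcons_cons -!rcons_cons walk_rcons2 (h_sym v) xv andbT.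
    by move: w; rewrite -!cat_cons walk_cat => /andP[].
  have /(acyclic cw) : uniq (x :: y :: rcons p1 v) by uniq_tac.
  by rewrite /= size_rcons.
have [x [p [sp _ u _]]] := long #|T|.
by have := max_card (mem (x :: p)); rewrite (card_uniqP u) /= sp ltnn.
Qed.

(** The bound of [#|U| - 1] edges in degree-sum form. Deleting a leaf lowers the sum by twice its
    degree, once for the leaf and once for its neighbour. *)
Lemma forest_bound (U : {set T}) : U != set0 ->
  \sum_(v in U) #|[set w in U | h v w]| + 2 <= 2 * #|U|.
Proof.
move: {2}#|U| (leqnn #|U|) => n; elim: n U => [|n IH] U leU U0.
  by move: leU; rewrite leqn0 cards_eq0 (negPf U0).
have [v vU dv] := forest_leaf U0.
have degD u : #|[set w in U | h u w]| = h u v + #|[set w in U :\ v | h u w]|.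
  rewrite (cardsD1 v) !inE vU /=; congr (_ + _); apply: eq_card => w.
  by rewrite !inE andbA.
have sumv : \sum_(u in U :\ v) (h u v : nat) = #|[set w in U | h v w]|.
  rewrite degD h_irr add0n -sum1_card; under [RHS]eq_bigl => u do rewrite inE.
  by rewrite big_mkcondr /=; apply: eq_bigr => u _; rewrite h_sym; case: (h v u).
rewrite (big_setD1 v) //= (eq_bigr _ (fun u _ => degD u)) big_split /= sumv.
have cU : #|U| = #|U :\ v|.+1 by rewrite (cardsD1 v) vU.
have [Uv0|Uv0] := eqVneq (U :\ v) set0.
  rewrite Uv0 big_set0 cU Uv0 cards0; have : #|[set w in U | h v w]| = 0.
    by rewrite -sumv Uv0 big_set0.
  lia.
have := IH (U :\ v) _ Uv0; rewrite cU in leU *; move=> /(_ leU); lia.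
Qed.

End Forest.

(** * Two edges with equal image lead to a contradiction *)

Section Injective.
Local Open Scope fset_scope.
Variables (T : finType) (g : rel T).
Hypotheses (g_sym : symmetric g) (g_irr : irreflexive g) (g3 : k_connected 3 g).
Variables (V : choiceType) (e' : rel V) (f : {set T} -> {fset V}).
Hypothesis f_circuit : forall C, circuitG g C ->
  circuitG' e' (fun x' => exists2 x, x \in C & f x = x').

Lemma edge_eq p q u v : g u v -> u \in [set p; q] -> v \in [set p; q] -> [set u; v] = [set p; q].
Proof.
move=> guv; have uv : u <> v by move=> uv; rewrite uv g_irr in guv.
by rewrite !inE => /orP[]/eqP eu /orP[]/eqP ev; subst; rewrite // setUC.
Qed.

(** As the interiors are disjoint, both ends of a common edge lie in [[set p; q]]. *)
Lemma ed_parallel p q P Q x : walk g (p :: rcons P q) -> uniq (p :: q :: P ++ Q) ->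
  x \in ed (p :: rcons P q) -> x \in ed (p :: rcons Q q) -> x = [set p; q].
Proof.
move=> w u xP xQ; have /edgesGP[y [z [gyz xE]]] := walk_ed w xP; subst x.
have both v : v \in p :: rcons P q -> v \in p :: rcons Q q -> v \in [set p; q].
  rewrite !inE !mem_rcons !inE; case: (v == p) => //; case: (v == q) => //= vP vQ.
  have : uniq (P ++ Q) by move: u => /= /and3P[].
  rewrite cat_uniq => /and3P[_ /hasPn/(_ v vQ) + _].
  by rewrite /= vP.
by apply: edge_eq => //; apply: both;
   [apply: (ed_mem xP)|apply: (ed_mem xQ)|apply: (ed_mem xP)|apply: (ed_mem xQ)];
   rewrite !inE eqxx ?orbT.
Qed.

(* The theta through [x] of [edge_theta] contains a circuit through [x] avoiding [y]; an ear
   of this circuit containing [y] completes it to a theta separating [x] from [y]. *)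
Lemma mono_theta_exists x y : x \in edgesG g -> y \in edgesG g -> x != y -> f x = f y ->
  exists s t a b m D, mono_theta g f s t a b m D /\ circuitG' e' D.
Proof.
move=> /edgesGP[p [q [gpq ->]]] /edgesGP[u [v [guv ->]]] xy fxy.
have pq : p != q by apply: contraTneq gpq => ->; rewrite g_irr.
have [P0 [Q [wP0 wQ u0 sP0 sQ]]] := edge_theta g_sym g_irr g3 gpq.
(* An edge on both paths would be [pq], that is [x]; so one of the two paths avoids [y]. *)
have [P [wP uP sP yP]] : exists P, [/\ walk g (p :: rcons P q), uniq (p :: rcons P q),
    0 < size P & [set u; v] \notin ed (p :: rcons P q)].
  have [yP|yP] := boolP ([set u; v] \in ed (p :: rcons P0 q)); last first.
    by exists P0; split=> //; uniq_tac.
  exists Q; split=> //; [by uniq_tac|apply/negP=> yQ].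
  by case/negP: xy; rewrite eq_sym; apply/eqP/(ed_parallel wP0 u0 yP yQ).
pose K := p :: rcons (rcons P q) p.
have [wK eK] := close_path g_sym gpq wP; rewrite -/K in wK eK.
have uK : uniq (p :: rcons P q) by [].
have yK : [set u; v] \notin ed K by rewrite eK !inE negb_or yP eq_sym.
pose U := [set z in p :: rcons P q].
have cU : 1 < #|U| by rewrite cardsE (card_uniqP uK) /= size_rcons.
have [s [m [t [/andP[sU tU] wm um mU ym]]]] := ear g_sym g_irr g3 guv cU.
have st : s != t by move: um; rewrite /= mem_rcons inE negb_or => /andP[/andP[]].
rewrite !inE in sU tU.
have [a [b [wa wb pab eab]]] := arcs wK sU tU st.
have wb' : walk g (s :: rcons (rev b) t) by rewrite path_rev walk_rev.
have eb' : ed (s :: rcons (rev b) t) = ed (t :: rcons b s) by rewrite path_rev ed_rev.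
rewrite -eb' in eab.
have ya : [set u; v] \notin ed (s :: rcons a t).
  by apply: contra yK => h; rewrite -/K eab inE h.
have yb : [set u; v] \notin ed (s :: rcons (rev b) t).
  by apply: contra yK => h; rewrite -/K eab inE h orbT.
have um' : uniq ((s :: t :: a ++ b) ++ m).
  rewrite cat_uniq (perm_uniq pab) uK /=; apply/andP; split.
    apply: contra mU => /hasP[z zm zU]; apply/hasP; exists z => //=.
    by rewrite inE -(perm_mem pab).
  by move: um; rewrite /= rcons_uniq => /and3P[_ _].
have th : theta g s t a (rev b) m.
  split=> //; first by uniq_tac.
  rewrite addnC (ed_size_gt0 ym ya) addnC (ed_size_gt0 ym yb) !andbT.
  by have := perm_size pab; clear - sP; rewrite size_rev /= size_cat size_rcons; lia.
have xab : [set p; q] \in ed (s :: rcons a t) :|: ed (s :: rcons (rev b) t).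
  by rewrite -eab -/K eK !inE eqxx orbT.
have [c1 c2 c3] := theta_circuits g_sym th.
(* [y] lies on the ear and [x] on one of the two arcs; in both cases the theta is permuted to have
   them on its first two paths. *)
have im z : z \in ed (s :: rcons a t) :|: ed (s :: rcons (rev b) t) :|: ed (s :: rcons m t) ->
    [/\ img f (ed (s :: rcons a t) :|: ed (s :: rcons (rev b) t)) (f z),
     img f (ed (s :: rcons a t) :|: ed (s :: rcons m t)) (f z) &
     img f (ed (s :: rcons (rev b) t) :|: ed (s :: rcons m t)) (f z)].
  move=> zin; move: xab; rewrite inE => /orP[xa|xb].
    have := theta_imgs g_sym f_circuit (theta_swap (theta_rot (theta_rot th))) xa ym fxy (z := z).
    case=> [|i1 i2 i3]; first by rewrite setUAC.
    by split; rewrite // setUC.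
  have := theta_imgs g_sym f_circuit (theta_rot th) xb ym fxy (z := z).
  case=> [|i1 i2 i3]; first by rewrite setUC setUA.
  by split; rewrite // setUC.
exists s, t, a, (rev b), m, (img f (ed (s :: rcons a t) :|: ed (s :: rcons (rev b) t))).
split; last exact: (f_circuit c1).
split=> // [z /im[] //|w [z zin <-]].
by apply: im; rewrite inE zin.
Qed.

(** By [mono_theta_all] every edge is mapped into [D], so the image of [C] is a circuit inside the
    circuit [D] and fills it. *)
Lemma img_circuit_all x y : x \in edgesG g -> y \in edgesG g -> x != y -> f x = f y ->
  exists D, circuitG' e' D /\ forall C, circuitG g C -> forall u, D u -> img f C u.
Proof.
move=> xE yE xy fxy.
have [s [t [a [b [m [D [mt cD]]]]]]] := mono_theta_exists xE yE xy fxy.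
exists D; split=> // C cC; apply: (circuit_sub (f_circuit cC) cD) => _ [z zC <-].
case: cC zC => c [_ _ cc ->] /imsetP[v vc ->].
by apply: (mono_theta_all g_sym g_irr g3 f_circuit mt); apply: next_cycle.
Qed.

Lemma degree_ge3 v : 3 <= #|[set w | g v w]|.
Proof.
rewrite leqNgt; apply/negP => lt.
by have [w] := nbr_avoid g_irr g3 v lt; rewrite inE andbN.
Qed.

(** Every circuit has an edge mapped to [d], so the edges not mapped to [d] form a forest. *)
Lemma avoid_forest (D : {fset V} -> Prop) d :
  (forall C, circuitG g C -> forall u, D u -> img f C u) -> D d ->
  \sum_v #|[set w | g v w && (f [set v; w] != d)]| + 2 <= 2 * #|T|.
Proof.
move=> hD dD; pose h := [rel v w | g v w && (f [set v; w] != d)].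
have hs : symmetric h by move=> v w; rewrite /= g_sym (setUC [set v]).
have hi : irreflexive h by move=> v; rewrite /= g_irr.
have ac x p : walk h (x :: rcons p x) -> uniq (x :: p) -> size p <= 1.
  move=> w u; rewrite leqNgt; apply/negP => sp.
  have wg : walk g (x :: rcons p x) by apply: sub_all w => q /andP[].
  have [y /edP[v [z [/(allP w) /= + ->]]] ey] := hD _ (circuit_walk wg u sp) _ dD.
  by rewrite ey eqxx andbF.
have T0 : [set: T] != set0.
  by have [lt _] := g3; rewrite -card_gt0 cardsT; apply: leq_trans lt.
have := forest_bound hs hi ac T0; rewrite cardsT.
rewrite (eq_bigl predT) => [|v]; last by rewrite inE.
by rewrite (eq_bigr (fun v => #|[set w | h v w]|)) // => v _; apply: eq_card => w; rewrite !inE.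
Qed.

Lemma edge_injective x y : x \in edgesG g -> y \in edgesG g -> f x = f y -> x = y.
Proof.
move=> xE yE fxy; apply/eqP; apply: contraT => xy.
have [D [cD hD]] := img_circuit_all xE yE xy fxy.
have [d1 [d2 [d3 [D1 D2 D3 [n12 n23 n13]]]]] := circuit_three cD.
have b1 := avoid_forest hD D1; have b2 := avoid_forest hD D2.
have b3 := avoid_forest hD D3.
(* There are at least three edges at [v], and the image of each differs from at least two of [d1],
   [d2], [d3]. *)
have le v : 6 <= #|[set w | g v w && (f [set v; w] != d1)]| +
   #|[set w | g v w && (f [set v; w] != d2)]| + #|[set w | g v w && (f [set v; w] != d3)]|.
  have cE d : #|[set w | g v w && (f [set v; w] != d)]| =
      \sum_(w in [set w | g v w]) (f [set v; w] != d : nat).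
    rewrite -sum1_card; under eq_bigl => w do rewrite inE.
    by under [RHS]eq_bigl => w do rewrite inE; rewrite big_mkcondr;
       apply: eq_bigr => w _; case: eqP.
  rewrite !cE -!big_split /=; have := degree_ge3 v; rewrite -sum1_card => ge3.
  apply: (@leq_trans (\sum_(w in [set w | g v w]) 2)).
    by rewrite sum_nat_const; move: ge3; rewrite sum1_card; lia.
  by apply: leq_sum => w _; do 3 case: eqP => ? //; congruence.
have: \sum_(v : T) 6 <= \sum_v (#|[set w | g v w && (f [set v; w] != d1)]| +
   #|[set w | g v w && (f [set v; w] != d2)]| + #|[set w | g v w && (f [set v; w] != d3)]|).
  by apply: leq_sum => v _; apply: le.
rewrite sum_nat_const !big_split /= => le6.
(* Adding the three forest bounds gives [n * 6 + 6 <= n * 6]. *)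
have arith a b c n : a + 2 <= 2 * n -> b + 2 <= 2 * n -> c + 2 <= 2 * n ->
  n * 6 <= a + b + c -> False by clear; lia.
by case: (arith _ _ _ _ b1 b2 b3 le6).
Qed.

End Injective.

(** * Preimages of stars *)

Section Cover.
Variables (T : finType) (g : rel T).
Hypothesis g_sym : symmetric g.

Definition arc_on (c : seq T) s t a :=
  [/\ walk g (s :: rcons a t), uniq (s :: t :: a) & {subset s :: t :: a <= c}].

Lemma arc_on_sym c s t a : arc_on c s t a -> arc_on c t s (rev a).
Proof.
case=> w u sub; split; first by rewrite path_rev walk_rev.
  by uniq_tac.
by move=> z; rewrite !inE mem_rev => h; apply: sub; rewrite !inE orbCA.
Qed.

Lemma arc_cover1 x p s t e : walk g (x :: rcons p x) -> uniq (x :: p) ->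
  s \in x :: p -> t \in x :: p -> s != t -> e \in ed (x :: rcons p x) ->
  exists a, arc_on (x :: p) s t a /\ e \in ed (s :: rcons a t).
Proof.
move=> w u sp tp st; have [a [b [wa wb pe ->]]] := arcs w sp tp st.
have uab : uniq (s :: t :: a ++ b) by rewrite (perm_uniq pe).
have sub z : [|| z == s, z == t, z \in a | z \in b] -> z \in x :: p.
  by rewrite -(perm_mem pe) !inE mem_cat.
rewrite inE => /orP[ea|eb].
  exists a; split=> //; split=> //; first by uniq_tac.
  by move=> z; rewrite !inE => h; apply: sub; case/or3P: h => ->; rewrite ?orbT.
exists (rev b); split; last by rewrite path_rev ed_rev.
apply: arc_on_sym; split=> //; first by uniq_tac.
by move=> z; rewrite !inE => h; apply: sub; case/or3P: h => ->; rewrite ?orbT.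
Qed.

(** The three vertices cut the circuit into three arcs, and [e], [e'] occupy at most two of them.
    Any two of the arcs form a path between two of the three vertices. *)
Lemma arc_cover2 x p s1 s2 s3 e e' : walk g (x :: rcons p x) -> uniq (x :: p) ->
  s1 \in x :: p -> s2 \in x :: p -> s3 \in x :: p -> uniq [:: s1; s2; s3] ->
  e \in ed (x :: rcons p x) -> e' \in ed (x :: rcons p x) ->
  let good s t := exists a, [/\ arc_on (x :: p) s t a, e \in ed (s :: rcons a t)
                                & e' \in ed (s :: rcons a t)] in
  [\/ good s1 s2, good s2 s3 | good s1 s3].
Proof.
move=> w u p1 p2 p3 u3 eC eC' good.
have good_sym s t : good s t -> good t s.
  by case=> a [/arc_on_sym h i j]; exists (rev a); rewrite !path_rev !ed_rev.
(* [s3] splits the arc [b] in two. The case of [s3] on the other arc follows by exchanging the roles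
   of [s1] and [s2]. *)
have half s t a b : walk g (s :: rcons a t) -> walk g (t :: rcons b s) ->
    perm_eq (s :: t :: a ++ b) (x :: p) ->
    ed (x :: rcons p x) = ed (s :: rcons a t) :|: ed (t :: rcons b s) ->
    s3 \in b -> [\/ good s t, good t s3 | good s s3].
  move=> wa wb pe ee /splitPr h; case: b / h wb pe ee => b1 b2 wb pe ee.
  have uab : uniq (s :: t :: a ++ b1 ++ s3 :: b2) by rewrite (perm_uniq pe).
  have sub z : z \in s :: t :: a ++ b1 ++ s3 :: b2 -> z \in x :: p by rewrite (perm_mem pe).
  have eb : t :: rcons (b1 ++ s3 :: b2) s = (t :: b1) ++ s3 :: rcons b2 s by rewrite rcons_cat.
  have [w1 w2] : walk g (t :: rcons b1 s3) /\ walk g (s3 :: rcons b2 s).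
    by move: wb; rewrite eb walk_cat rcons_cons => /andP.
  have e1 : s :: rcons (a ++ t :: b1) s3 = (s :: a) ++ t :: rcons b1 s3 by rewrite rcons_cat.
  have e2 : s3 :: rcons (b2 ++ s :: a) t = (s3 :: b2) ++ s :: rcons a t by rewrite rcons_cat.
  have A1 : arc_on (x :: p) s s3 (a ++ t :: b1).
    split; [by rewrite e1 walk_cat rcons_cons wa w1|by uniq_tac|].
    by move=> z h; apply: sub; move: h; rewrite !(inE, mem_cat); do !case: (_ \in _) => //=;
       do !case: eqP => //=.
  have A2 : arc_on (x :: p) s3 t (b2 ++ s :: a).
    split; [by rewrite e2 walk_cat rcons_cons wa w2|by uniq_tac|].
    by move=> z h; apply: sub; move: h; rewrite !(inE, mem_cat); do !case: (_ \in _) => //=;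
       do !case: eqP => //=.
  have A3 : arc_on (x :: p) t s (b1 ++ s3 :: b2).
    split; [by []|by uniq_tac|].
    by move=> z h; apply: sub; move: h; rewrite !(inE, mem_cat); do !case: (_ \in _) => //=;
       do !case: eqP => //=.
  have ec : ed (x :: rcons p x) =
      ed (s :: rcons a t) :|: (ed (t :: rcons b1 s3) :|: ed (s3 :: rcons b2 s)).
    by rewrite ee eb ed_cat rcons_cons.
  have g1 : e \in ed (s :: rcons a t) :|: ed (t :: rcons b1 s3) ->
            e' \in ed (s :: rcons a t) :|: ed (t :: rcons b1 s3) -> good s s3.
    by move=> h h'; exists (a ++ t :: b1); rewrite e1 ed_cat rcons_cons.
  have g2 : e \in ed (s3 :: rcons b2 s) :|: ed (s :: rcons a t) ->
            e' \in ed (s3 :: rcons b2 s) :|: ed (s :: rcons a t) -> good t s3.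
    by move=> h h'; apply: good_sym; exists (b2 ++ s :: a); rewrite e2 ed_cat rcons_cons.
  have g3 : e \in ed (t :: rcons b1 s3) :|: ed (s3 :: rcons b2 s) ->
            e' \in ed (t :: rcons b1 s3) :|: ed (s3 :: rcons b2 s) -> good s t.
    by move=> h h'; apply: good_sym; exists (b1 ++ s3 :: b2); rewrite eb ed_cat rcons_cons.
  move: eC eC'; rewrite ec !inE => /or3P[]h /or3P[]h';
    first [by apply: Or33; apply: g1; rewrite inE ?h ?h' ?orbT
          |by apply: Or32; apply: g2; rewrite inE ?h ?h' ?orbT
          |by apply: Or31; apply: g3; rewrite inE ?h ?h' ?orbT].
have /and3P[] := u3; rewrite !inE negb_or => /andP[n12 n13] n23 _.
have [a [b [wa wb pe ee]]] := arcs w p1 p2 n12.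
have : s3 \in s1 :: s2 :: a ++ b by rewrite (perm_mem pe).
rewrite !inE mem_cat !(eq_sym s3) (negPf n13) (negPf n23) /= => /orP[h|h].
  have pe' : perm_eq (s2 :: s1 :: b ++ a) (x :: p).
    apply: perm_trans pe; rewrite -[s2 :: s1 :: b ++ a]/([:: s2] ++ [:: s1] ++ (b ++ a)).
    by rewrite perm_catCA /= !perm_cons perm_catC.
  have ee' : ed (x :: rcons p x) = ed (s2 :: rcons b s1) :|: ed (s1 :: rcons a s2).
    by rewrite ee setUC.
  case: (half _ _ _ _ wb wa pe' ee' h) => [/good_sym h'|h'|h'];
    by [exact: Or31|exact: Or33|exact: Or32].
exact: half wa wb pe ee h.
Qed.
End Cover.

Section StarPreimages.
Local Open Scope fset_scope.
Variables (T : finType) (g : rel T).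
Hypotheses (g_sym : symmetric g) (g_irr : irreflexive g) (g3 : k_connected 3 g).
Variables (V : choiceType) (e' : rel V) (f : {set T} -> {fset V}).
Hypothesis f_circuit : forall C, circuitG g C ->
  circuitG' e' (fun x' => exists2 x, x \in C & f x = x').
Implicit Types (x y : {set T}) (a : V).

Let f_inj := edge_injective g_sym g_irr g3 f_circuit.

Lemma circuit_edges C x : circuitG g C -> x \in C -> x \in edgesG g.
Proof.
case=> c [_ _ cc ->] /imsetP[v vc ->]; apply/edgesGP.
by exists v, (next c v); split=> //; apply: next_cycle.
Qed.

Lemma star_two C x a : circuitG g C -> x \in C -> a \in f x ->
  exists2 y, y \in C & y != x /\ a \in f y.
Proof.
move=> cC xC ax; have ix : img f C (f x) by exists x.
have [_ [[y yC <-] ay n]] := circuit_deg2 (f_circuit cC) ix ax.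
by exists y => //; split=> //; apply: contra_not_neq n => ->.
Qed.

(** By injectivity [x] and [y] have different images, which are then the only edges of the image
    circuit at [a]; injectivity also carries this back to [z]. *)
Lemma star_three C x y z a : circuitG g C -> x \in C -> y \in C -> z \in C ->
  a \in f x -> a \in f y -> a \in f z -> x != y -> z = x \/ z = y.
Proof.
move=> cC xC yC zC ax ay az xy.
have [ix iy iz] : [/\ img f C (f x), img f C (f y) & img f C (f z)].
  by split; [exists x|exists y|exists z].
have E := circuit_edges cC.
have nxy : f x <> f y by move/(f_inj (E _ xC) (E _ yC)) => e; rewrite e eqxx in xy.
by case: (circuit_deg3 (f_circuit cC) ix iy iz ax ay az nxy) => /f_inj h;
   [left|right]; apply: h; apply: E.
Qed.

(** Take the theta of [pq] and two paths [P], [Q]. If neither path closes to such a circuit, both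
    contain edges of [X_a], and [P] contains two because [pq] is not in [X_a]; the circuit of [P]
    and [Q] would then have three. *)
Lemma circuit_off_star p q a : g p q -> a \notin f [set p; q] ->
  exists s c, [/\ walk g (s :: rcons c s), uniq (s :: c), 1 < size c,
    [set p; q] \in ed (s :: rcons c s) &
    forall y, y \in ed (s :: rcons c s) -> a \notin f y].
Proof.
move=> gpq apq; have [P [Q [wP wQ u sP sQ]]] := edge_theta g_sym g_irr g3 gpq.
have one R : walk g (p :: rcons R q) -> uniq (p :: rcons R q) -> 0 < size R ->
    (forall y, y \in ed (p :: rcons R q) -> a \notin f y) ->
    exists s c, [/\ walk g (s :: rcons c s), uniq (s :: c), 1 < size c,
    [set p; q] \in ed (s :: rcons c s) &
    forall y, y \in ed (s :: rcons c s) -> a \notin f y].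
  move=> wR uR sR off; have [wK eK] := close_path g_sym gpq wR.
  exists p, (rcons R q); rewrite wK eK size_rcons; split=> //; first by rewrite !inE eqxx orbT.
  by move=> y; rewrite !inE => /orP[/off|/eqP->].
have uP : uniq (p :: rcons P q) by uniq_tac.
have uQ : uniq (p :: rcons Q q) by uniq_tac.
apply: NNPP => no.
have ex R : walk g (p :: rcons R q) -> uniq (p :: rcons R q) -> 0 < size R ->
    exists2 y, y \in ed (p :: rcons R q) & a \in f y.
  move=> wR uR sR; apply: NNPP => n; apply/no/(one R wR uR sR) => y yR.
  by apply/negP => ay; apply: n; exists y.
have [x xP ax] := ex P wP uP sP; have [z zQ az] := ex Q wQ uQ sQ.
have [wK eK] := close_path g_sym gpq wP.
have cK : circuitG g (ed (p :: rcons (rcons P q) p)).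
  by apply: circuit_walk; rewrite // size_rcons ltnS.
have [|y yK [yx ay]] := star_two cK _ ax; first by rewrite eK inE xP.
have yP : y \in ed (p :: rcons P q).
  by move: yK; rewrite eK !inE => /orP[//|/eqP ey]; rewrite -ey ay in apq.
have cPQ : circuitG g (ed (p :: rcons P q) :|: ed (p :: rcons Q q)).
  by apply: theta_circuit; rewrite // addn_gt0 sP.
have xy : x != y by rewrite eq_sym.
have zP : z \in ed (p :: rcons P q).
  by have [|||->|->] := star_three cPQ _ _ _ ax ay az xy; rewrite ?inE ?xP ?yP ?zQ ?orbT.
by rewrite (ed_parallel g_irr wP u zP zQ) (negPf apq) in az.
Qed.

(* Three disjoint paths between the two circuits would provide a circuit with three edges
   mapped to edges at [a]. *)
Lemma disjoint_circuits_star (x1 x2 : T) (p1 p2 : seq T) a (e1 e2 : {set T}) :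
  walk g (x1 :: rcons p1 x1) -> uniq (x1 :: p1) -> 1 < size p1 ->
  walk g (x2 :: rcons p2 x2) -> uniq (x2 :: p2) -> 1 < size p2 ->
  (forall v, v \in x1 :: p1 -> v \in x2 :: p2 -> False) ->
  e1 \in ed (x1 :: rcons p1 x1) -> e2 \in ed (x2 :: rcons p2 x2) ->
  a \in f e1 -> a \in f e2 -> False.
Proof.
move=> w1 u1 s1 w2 u2 s2 dis e1C e2C a1 a2.
have c1 : circuitG g (ed (x1 :: rcons p1 x1)) by apply: circuit_walk.
have [e1' e1C' [n1 a1']] := star_two c1 e1C a1.
pose A := [set z in x1 :: p1]; pose B := [set z in x2 :: p2].
have [|||w [[hw dw] tA tB]] := @disjoint_paths3 T g g3 3 A B.
- by [].
- by rewrite cardsE (card_uniqP u1).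
- by rewrite cardsE (card_uniqP u2).
have [h /fin_all_exists[t hE]] := fin_all_exists (fun i => ABpath_consE (hw i).1).
have [q /fin_all_exists[l lE]] := fin_all_exists (fun i => ABpath_rconsE (hw i).1).
have wE i : w i = h i :: t i by case: (hE i).
have wE' i : w i = rcons (q i) (l i) by case: (lE i).
have hA i : h i \in x1 :: p1 by case: (hE i); rewrite inE.
have lB i : l i \in x2 :: p2 by case: (lE i); rewrite inE.
have hneq i j : i != j -> h i != h j.
  by apply: contra_neq => eq; apply: (dw i j (h i)); rewrite ?wE ?eq mem_head.
have lneq i j : i != j -> l i != l j.
  by apply: contra_neq => eq; apply: (dw i j (l i)); rewrite ?wE' ?eq mem_rcons mem_head.
have wwalk i : walk g (w i).
  by have [+ _] := hw i; case: (w i) => // v s /and3P[].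
(* If an arc [b] of the first circuit contains [e1] and [e1'], it is closed up by path [i], an arc
   [c] of the second circuit through [e2], and path [j] backwards. The new circuit has three edges
   in [X_a]. *)
have bad i j : i != j -> (exists b, [/\ arc_on g (x1 :: p1) (h i) (h j) b,
    e1 \in ed (h i :: rcons b (h j)) & e1' \in ed (h i :: rcons b (h j))]) -> False.
  move=> ij [b [[wb ub sb] e1b e1b']].
  have [c [[wc uc sc] e2c]] := arc_cover1 g_sym w2 u2 (lB i) (lB j) (lneq _ _ ij) e2C.
  pose M := t i ++ c ++ rev (t j).
  have eM : h i :: rcons M (h j) = q i ++ l i :: c ++ l j :: rev (q j).
    have -> : l j :: rev (q j) = rev (w j) by rewrite wE' rev_rcons.
    have -> : rcons M (h j) = t i ++ c ++ rev (w j) by rewrite (wE j) rev_cons /M !rcons_cat.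
    by rewrite -(cat_rcons (l i) (q i)) -wE' (wE i).
  have wM : walk g (h i :: rcons M (h j)).
    rewrite eM walk_cat -wE' wwalk -cat_cons walk_cat rcons_cons wc.
    by rewrite -rev_rcons -wE' walk_rev ?wwalk.
  have e2M : e2 \in ed (h i :: rcons M (h j)).
    by rewrite eM ed_cat -cat_cons ed_cat rcons_cons !inE e2c orbT.
  have tnA k z : z \in t k -> z \in x1 :: p1 -> False.
    move=> zt zA; case/negP: (tA k); rewrite wE /=; apply/hasP; exists z => //=.
    by rewrite inE.
  have tB' k z : z \in t k -> z \in x2 :: p2 -> z = l k.
    move=> zt zB; have : z \in rcons (q k) (l k) by rewrite -wE' wE inE zt orbT.
    rewrite mem_rcons inE => /orP[/eqP//|zq].
    by case/negP: (tB k _ _ (wE' k)); apply/hasP; exists z => //=; rewrite inE.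
  have cB z : z \in c -> z \in x2 :: p2 by move=> zc; apply: sc; rewrite !inE zc !orbT.
  have [lic ljc] : l i \notin c /\ l j \notin c.
    by move: uc; rewrite /= !inE negb_or => /and3P[/andP[_ ->] -> _].
  have MA z : z \in M -> z \in x1 :: p1 -> False.
    rewrite !mem_cat mem_rev => /or3P[/tnA//|/cB zB zA|/tnA//]; exact: dis zA zB.
  have uw k : uniq (t k) by have [_] := hw k; rewrite wE => /andP[].
  have uM : uniq M.
    rewrite /M !cat_uniq rev_uniq !uw; move: (uc) => /= /and3P[_ _ ->] /=.
    rewrite andbT; apply/andP; split; apply/hasPn => z /=.
      rewrite mem_cat mem_rev => /orP[zc|zj]; apply/negP => zi.
        by case/negP: lic; rewrite -(tB' i z) ?cB.
      by case/eqP: ij; apply: (dw i j z); rewrite wE inE ?zi ?zj orbT.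
    rewrite mem_rev => zj; apply/negP => zc.
    by case/negP: ljc; rewrite -(tB' j z) ?cB.
  have uall : uniq (h i :: h j :: b ++ M).
    have -> : h i :: h j :: b ++ M = (h i :: h j :: b) ++ M by [].
    rewrite cat_uniq ub uM andbT /=; apply/hasPn => z zM; apply/negP => /= zb.
    exact: MA zM (sb _ zb).
  have cc := theta_circuit g_sym wb wM uall.
  have {}cc : circuitG g (ed (h i :: rcons b (h j)) :|: ed (h i :: rcons M (h j))).
    (* The inner path [M] is nonempty: with [t i] empty, [h i] would lie on both circuits. *)
    apply: cc; rewrite addn_gt0; apply/orP; right; rewrite /M !size_cat.
    case: (t i) (wE i) => [|? ?] // ei; case: (dis (h i) (hA i)).
    have := wE' i; rewrite ei; case: (q i) => [[->]|? [|? ?]] //; exact: lB.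
  have n1' : e1 != e1' by rewrite eq_sym.
  have e2V v : v \in e2 -> v \in x2 :: p2.
    by move=> /(ed_mem e2c); rewrite inE mem_rcons => h'; apply: sc; rewrite !inE in h' *.
  have bV e v : e \in ed (h i :: rcons b (h j)) -> v \in e -> v \in x1 :: p1.
    by move=> eb /(ed_mem eb); rewrite inE mem_rcons => h'; apply: sb; rewrite !inE in h' *.
  have [v ve2] : exists v, v \in e2.
    by case/edP: e2c => v [v' [_ ->]]; exists v; rewrite !inE eqxx.
  have [|||ee|ee] := star_three cc _ _ _ a1 a1' a2 n1'; rewrite ?inE ?e1b ?e1b' ?e2M ?orbT //.
    by apply: (dis v _ (e2V _ ve2)); apply: (bV e1) => //; rewrite -ee.
  by apply: (dis v _ (e2V _ ve2)); apply: (bV e1') => //; rewrite -ee.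
pose i0 : 'I_3 := ord0; pose i1 : 'I_3 := inord 1; pose i2 : 'I_3 := inord 2.
have [n01 n12 n02] : [/\ i0 != i1, i1 != i2 & i0 != i2].
  by split; apply/eqP => /(congr1 val); rewrite /= ?inordK.
have u3 : uniq [:: h i0; h i1; h i2] by rewrite /= !inE negb_or !hneq.
by case: (arc_cover2 g_sym w1 u1 (hA i0) (hA i1) (hA i2) u3 e1C e1C') => /bad; apply.
Qed.

End StarPreimages.

(** * Components outside the preimage of a star *)

Section Components.
Local Open Scope fset_scope.
Variables (T : finType) (g : rel T).
Hypotheses (g_sym : symmetric g) (g_irr : irreflexive g) (g3 : k_connected 3 g).
Variables (V : choiceType) (e' : rel V) (f : {set T} -> {fset V}).
Hypothesis f_circuit : forall C, circuitG g C ->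
  circuitG' e' (fun x' => exists2 x, x \in C & f x = x').
Implicit Types (x y : {set T}) (a : V).

Let f_inj := edge_injective g_sym g_irr g3 f_circuit.

(** The graph left after deleting the edges of [X_a]. *)
Definition off_star a := [rel u v | g u v && (a \notin f [set u; v])].

Lemma off_star_sym a : symmetric (off_star a).
Proof. by move=> u v; rewrite /= g_sym (setUC [set u]). Qed.

Lemma off_star_csym a : connect_sym (off_star a).
Proof. exact/sym_connect_sym/off_star_sym. Qed.

(** Take a circuit through both edges. By [circuit_conn_avoid] on its image, it suffices to compare
    edges outside [X_a] whose images share a vertex [b]. Each lies on a circuit avoiding [X_a], and
    by [disjoint_circuits_star] for [b] these circuits meet, so they lie in one component. *)
Lemma off_star_connected p q u v a :
  g p q -> g u v -> a \notin f [set p; q] -> a \notin f [set u; v] ->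
  connect (off_star a) p u.
Proof.
move=> gpq guv apq auv.
have uv : u != v by apply: contraTneq guv => ->; rewrite g_irr.
have [s [m [t [/andP[sU tU] wm um mU zm]]]] : exists s m t,
    [/\ (s \in [set u; v]) && (t \in [set u; v]), walk g (s :: rcons m t),
    uniq (s :: rcons m t), ~~ has (mem [set u; v]) m & [set p; q] \in ed (s :: rcons m t)].
  by apply: ear => //; rewrite cards2 uv.
have st : s != t by move: um; rewrite /= mem_rcons inE negb_or => /andP[/andP[]].
have est : [set s; t] = [set u; v].
  apply/eqP; rewrite eqEcard !cards2 uv st leqnn andbT.
  by apply/subsetP => z; rewrite !inE => /orP[]/eqP->; [move: sU|move: tU]; rewrite !inE.
have gst : g s t.
  move: sU tU st; rewrite !inE => /orP[]/eqP-> /orP[]/eqP->; rewrite ?eqxx //.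
  by rewrite g_sym.
have near w w' : g w w' -> a \notin f [set w; w'] -> connect (off_star a) w w'.
  by move=> gw aw; apply: connect1; rewrite /= gw aw.
have pair w w' z z' : g w w' -> a \notin f [set w; w'] -> [set w; w'] = [set z; z'] ->
    connect (off_star a) w z.
  move=> gw aw ee; have : z \in [set w; w'] by rewrite ee !inE eqxx.
  by rewrite !inE => /orP[]/eqP->; [exact: connect0|exact: near].
(* An ear without interior is the edge [uv], so the two given edges coincide. *)
have [m0|m0] := posnP (size m).
  move: zm; rewrite (size0nil m0) /= ed_cons2 ed1 setU0 inE est => /eqP.
  exact: pair.
have [wC eC] := close_path g_sym gst wm; rewrite est in eC.
have cC : circuitG g (ed (s :: rcons (rcons m t) s)).
  by apply: circuit_walk; rewrite // size_rcons ltnS.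
set C := ed _ in eC cC.
pose N (b : {fset V}) := exists w w', [/\ g w w', b = f [set w; w'] & connect (off_star a) p w].
have pC : [set p; q] \in C by rewrite eC !inE zm.
have uC : [set u; v] \in C by rewrite eC !inE eqxx orbT.
have ip : img f C (f [set p; q]) by exists [set p; q].
have iu : img f C (f [set u; v]) by exists [set u; v].
have Np : N (f [set p; q]) by exists p, q; split; rewrite ?connect0.
have edge w w' : g w w' -> [set w; w'] \in edgesG g by move=> h; apply/edgesGP; exists w, w'.
have [|w [w' [gw ef pw]]] := circuit_conn_avoid (N := N) (f_circuit cC) _ ip apq Np iu auv.
  move=> b x' y' dx dy ax ay bx by_ [w [w' [gw ex pw]]].
  case: dy => y yC ey; have /edgesGP[z [z' [gz yE]]] := circuit_edges cC yC.
  exists z, z'; split; rewrite -?yE //; apply: NNPP => npz.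
  rewrite ex in ax bx; rewrite -ey yE in ay by_.
  have [s1 [c1 [w1 u1 z1 e1 o1]]] := circuit_off_star g_sym g_irr g3 f_circuit gw ax.
  have [s2 [c2 [w2 u2 z2 e2 o2]]] := circuit_off_star g_sym g_irr g3 f_circuit gz ay.
  have conn s0 c : walk g (s0 :: rcons c s0) ->
      (forall y0, y0 \in ed (s0 :: rcons c s0) -> a \notin f y0) ->
      {in s0 :: rcons c s0 &, forall r r', connect (off_star a) r r'}.
    move=> w0 o0; have wo : walk (off_star a) (s0 :: rcons c s0).
      apply/allP => -[r r'] rr /=; rewrite (allP w0 _ rr) /=.
      by apply: o0; apply/edP; exists r, r'.
    have from r : r \in s0 :: rcons c s0 -> connect (off_star a) s0 r.
      move: wo; rewrite walk_path; move: (rcons c s0) => c'.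
      by move=> pc' rc'; apply: (path_connect pc').
    by move=> r r' /from h /from; apply: connect_trans; rewrite off_star_csym.
  have in1 : w \in s1 :: rcons c1 s1 by apply: (ed_mem e1); rewrite !inE eqxx.
  have in2 : z \in s2 :: rcons c2 s2 by apply: (ed_mem e2); rewrite !inE eqxx.
  apply: (disjoint_circuits_star g_sym g_irr g3 f_circuit w1 u1 z1 w2 u2 z2 _ e1 e2 bx by_).
  move=> r r1 r2; apply: npz; apply: (connect_trans pw).
  apply: (connect_trans (y := r)).
    by apply: (conn _ _ w1 o1) => //; rewrite inE mem_rcons; move: r1; rewrite !inE orbA orbb.
  by apply: (conn _ _ w2 o2) => //; rewrite inE mem_rcons; move: r2; rewrite !inE orbA orbb.
apply: connect_trans pw _; apply: (pair w w' u v gw).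
  by rewrite -ef.
by apply: f_inj; rewrite ?edge.
Qed.

(** A path from [u] to [v] avoiding [X_a], closed by [uv], would be a circuit with exactly one edge
    in [X_a]. *)
Lemma star_ends u v a : g u v -> a \in f [set u; v] -> ~~ connect (off_star a) u v.
Proof.
move=> guv auv; apply/negP => /connectP[p0 + lv0].
move=> /shortenP pp0; case: pp0 lv0 => p pp up _ lv.
case/lastP: p lv pp up => [/= vu|p w]; first by rewrite vu g_irr in guv.
rewrite last_rcons => <- {w} pp up.
have wo : walk (off_star a) (u :: rcons p v) by rewrite walk_path.
have wg : walk g (u :: rcons p v) by apply: sub_all wo => q /andP[].
have off y : y \in ed (u :: rcons p v) -> a \notin f y.
  by case/edP=> [w [w' [/(allP wo)/andP[_ ?] ->]]].
have [wC eC] := close_path g_sym guv wg.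
have sp : 0 < size p.
  case: p {pp up wg off eC wC} wo => //=; rewrite walk_cons2 => /andP[/andP[_ ]].
  by rewrite auv.
have cC : circuitG g (ed (u :: rcons (rcons p v) u)).
  by apply: circuit_walk; rewrite // size_rcons ltnS.
have [|y] := star_two f_circuit cC _ auv; first by rewrite eC !inE eqxx orbT.
by rewrite eC !inE => /orP[/off/negP n|/eqP->] []; rewrite ?eqxx.
Qed.

Lemma vertex_star u v a : g u v -> a \in f [set u; v] ->
  exists w, forall p q, g p q -> (a \in f [set p; q]) = (w \in [set p; q]).
Proof.
move=> guv auv.
(* Otherwise both [u] and [v] have an edge outside [X_a], and [off_star_connected] joins them
   against [star_ends]. *)
have [w hw] : exists w, forall n, g w n -> a \in f [set w; n].
  apply: NNPP => no.
  have ex w : exists2 n, g w n & a \notin f [set w; n].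
    apply: NNPP => nw; apply: no; exists w => n gn; apply: contraT => an.
    by case: nw; exists n.
  have [[n1 g1 a1] [n2 g2 a2]] := (ex u, ex v).
  by case/negP: (star_ends guv auv); apply: off_star_connected g1 g2 a1 a2.
exists w => p q gpq; apply/idP/idP => [apq|]; last first.
  rewrite !inE => /orP[]/eqP ew; subst; first exact: hw.
  by rewrite setUC hw // g_sym.
apply: contraT => wpq.
have pq : p != q by apply: contraTneq gpq => ->; rewrite g_irr.
(* An edge [pq] of [X_a] not at [w] lies on a circuit with an edge [wn], obtained from an ear. The
   two edges of this circuit at [w] are in [X_a] as well, which makes three. *)
have [|n /andP[gwn npq]] := nbr_avoid g_irr g3 (S := [set p; q]) w; first by rewrite cards2 pq.
have wn : w != n by apply: contraTneq gwn => ->; rewrite g_irr.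
have [s [m [t [/andP[sU tU] wm um mU zm]]]] : exists s m t,
    [/\ (s \in [set w; n]) && (t \in [set w; n]), walk g (s :: rcons m t),
    uniq (s :: rcons m t), ~~ has (mem [set w; n]) m & [set p; q] \in ed (s :: rcons m t)].
  by apply: ear => //; rewrite cards2 wn.
have {s t sU tU wm um mU zm} [m' [wm um zm]] : exists m', [/\ walk g (w :: rcons m' n),
    uniq (w :: rcons m' n) & [set p; q] \in ed (w :: rcons m' n)].
  have st : s != t by move: um; rewrite /= mem_rcons inE negb_or => /andP[/andP[]].
  move: sU tU st; rewrite !inE => /orP[]/eqP es /orP[]/eqP et; subst; rewrite ?eqxx // => _.
    by exists m.
  by exists (rev m); rewrite path_rev walk_rev // ed_rev rev_uniq.
have [wC eC] := close_path g_sym gwn wm.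
case: m' wm um zm wC eC => [|k m'] wm um zm wC eC.
  move: zm; rewrite /= ed_cons2 ed1 setU0 inE => /eqP e.
  by move: wpq; rewrite e !inE eqxx.
have cC : circuitG g (ed (w :: rcons (rcons (k :: m') n) w)).
  by apply: circuit_walk; rewrite // size_rcons.
have gwk : g w k by move: wm; rewrite /= walk_cons2 => /andP[].
have kn : k != n.
  have : k \notin rcons m' n by move: um => /= /and3P[].
  by rewrite mem_rcons inE negb_or => /andP[].
have wk : w != k by apply: contraTneq gwk => ->; rewrite g_irr.
have ne : [set w; k] != [set w; n].
  apply/eqP => /setP/(_ k); rewrite !inE eqxx orbT eq_sym (negPf wk) (negPf kn).
  by [].
have wkC : [set w; k] \in ed (w :: rcons (rcons (k :: m') n) w).
  by rewrite eC /= ed_cons2 !inE eqxx.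
have wnC : [set w; n] \in ed (w :: rcons (rcons (k :: m') n) w).
  by rewrite eC !inE eqxx orbT.
have zC : [set p; q] \in ed (w :: rcons (rcons (k :: m') n) w) by rewrite eC inE zm.
by case: (star_three g_sym g_irr g3 f_circuit cC wkC wnC zC (hw _ gwk) (hw _ gwn) apq ne) => e;
   move: wpq; rewrite e !inE eqxx.
Qed.

End Components.

(** * The bijection between the vertices *)

Local Open Scope fset_scope.

Theorem theorem1p2 (T : finType) (g : rel T)
  (g_sym : symmetric g) (g_irr : irreflexive g)
  (g_3conn : k_connected 3 g)
  (V' : choiceType) (e' : rel V')
  (e'_sym : symmetric e') (e'_irr : irreflexive e')
  (e'_noiso : forall v : V', exists u, e' v u)
  (f : {set T} -> {fset V'})
  (hf : circuit_surjection g e' f) :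
  exists phi : T -> V',
    bijective phi /\ forall u v, g u v -> f [set u; v] = [fset phi u; phi v].
Proof.
have [f_edge f_surj f_circuit] := hf.
have f_inj := edge_injective g_sym g_irr g_3conn f_circuit.
have edge u v : g u v -> [set u; v] \in edgesG g by move=> h; apply/edgesGP; exists u, v.
(* As [a] is not isolated, [X_a] is nonempty, which [vertex_star] requires. *)
have star a : exists w, forall p q, g p q -> (a \in f [set p; q]) = (w \in [set p; q]).
  have [b ab] := e'_noiso a.
  have [|x /edgesGP[u [v [guv ->]]] fx] := f_surj [fset a; b]; first by exists a, b.
  by apply: (vertex_star g_sym g_irr g_3conn f_circuit guv); rewrite fx !inE eqxx.
have two v : exists n1 n2, [/\ g v n1, g v n2 & n1 != n2].
  have [|n1 /andP[g1 _]] := nbr_avoid g_irr g_3conn (S := set0) v; first by rewrite cards0.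
  have [|n2 /andP[g2 n21]] := nbr_avoid g_irr g_3conn (S := [set n1]) v; first by rewrite cards1.
  by exists n1, n2; split=> //; move: n21; rewrite inE eq_sym.
have ends u v : g u v -> exists a b, [/\ a != b & f [set u; v] = [fset a; b]].
  move=> /edge/f_edge[a [b [ab ->]]]; exists a, b; split=> //.
  by apply: contraTneq ab => ->; rewrite e'_irr.
have pair a b u v : g u v -> a != b -> a \in f [set u; v] -> b \in f [set u; v] ->
    f [set u; v] = [fset a; b].
  move=> /ends[c [d [cd ->]]] ab; rewrite !inE => /orP[]/eqP ea /orP[]/eqP eb; subst => //.
  - by rewrite eqxx in ab.
  - by rewrite fsetUC.
  - by rewrite eqxx in ab.
pose is_star a w := forall p q, g p q -> (a \in f [set p; q]) = (w \in [set p; q]).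
(* Otherwise two edges at [w] would both be mapped to [ab], against injectivity. *)
have star_inj a b w : is_star a w -> is_star b w -> a = b.
  move=> sa sb; apply/eqP; apply: contraT => ab.
  have [n1 [n2 [g1 g2 n12]]] := two w.
  have h n : g w n -> f [set w; n] = [fset a; b].
    by move=> gn; apply: pair => //; rewrite ?sa ?sb // !inE eqxx.
  have /setP/(_ n1) : [set w; n1] = [set w; n2] by apply: f_inj; rewrite ?edge // !h.
  rewrite !inE eqxx orbT (negPf n12) orbF => /esym/eqP e.
  by rewrite e g_irr in g1.
(* For an edge [wn] with image [ab], the vertices with stars [X_a] and [X_b] are different ends of
   [wn], so one of them is [w]. *)
have ex w : exists a, is_star a w.
  have [n [_ [gwn _ _]]] := two w; have [a [b [ab fe]]] := ends _ _ gwn.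
  have [[va sa] [vb sb]] := (star a, star b).
  have va_in : va \in [set w; n] by rewrite -sa // fe !inE eqxx.
  have vb_in : vb \in [set w; n] by rewrite -sb // fe !inE eqxx orbT.
  have vab : va <> vb.
    by move=> e; move: ab; rewrite e in sa; rewrite (star_inj _ _ _ sa sb) eqxx.
  move: va_in vb_in; rewrite !inE => /orP[]/eqP ea /orP[]/eqP eb; subst => //.
  - by exists a.
  - by exists b.
have [phi sphi] := fin_all_exists ex.
(* A neighbour [n] of [u] other than [v] gives an edge [un] in the star of [u] and not in that of
   [v]. *)
have phi_inj : injective phi.
  move=> u v e; apply/eqP; apply: contraT => uv.
  have [n /andP[gn]] : exists n, g u n && (n \notin [set v]).
    by apply: (nbr_avoid g_irr g_3conn); rewrite cards1.
  rewrite inE => nv.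
  have : phi u \in f [set u; n] by rewrite sphi // !inE eqxx.
  by rewrite e sphi // !inE eq_sym (negPf uv) eq_sym (negPf nv).
exists phi; split.
  have [w0 _] : exists w0 : T, True.
    by have [lt _] := g_3conn; have /card_gt0P[w _] := leq_trans (ltn0Sn _) lt; exists w.
  (* The default [w0] is never returned: the vertex whose star is [X_a] is mapped to [a], so [pick]
     succeeds. *)
  exists (fun a => odflt w0 [pick v | phi v == a]) => [v|a].
    by case: pickP => [w /eqP/phi_inj|/(_ v)/eqP].
  case: pickP => [w /eqP//|no].
  have [w sw] := star a.
  by have := no w; rewrite (star_inj _ _ _ (sphi w) sw) eqxx.
move=> u v guv; apply: pair => //.
- by apply: contraTneq guv => /phi_inj->; rewrite g_irr.
- by rewrite sphi // !inE eqxx.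
- by rewrite sphi // !inE eqxx orbT.
Qed.
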